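(* Let $\mathbb{X}\subseteq\mathbb{R}^n$ be open, $\mathbb{U}$ a metric space, and let $f:\mathbb{X}\times\mathbb{U}\to\mathbb{R}^n$ be continuous and satisfy the local Lipschitz condition: for each $\xi\in\mathbb{X}$ and each compact $\mathbb{U}_0\subseteq\mathbb{U}$ there exist a neighborhood $\mathcal{V}$ of $\xi$ and a constant $L$ such that $\|f(x,u)-f(z,u)\|_{\mathbb{R}^n}\le L\|x-z\|_{\mathbb{R}^n}$ (Euclidean norms) for all $x,z\in\mathcal{V}$ and all $u\in\mathbb{U}_0$. Let $\bar{x}\in\mathbb{X}$, $\bar{u}\in\mathbb{U}$ with $f(\bar{x},\bar{u})=0$. Suppose that $\bar{x}$ is an asymptotically stable equilibrium of the autonomous system $\dot{x}=f(x,\bar{u})$, with domain of attraction $\mathcal{O}$. Then: (1) Let $K$ be a compact subset of $\mathcal{O}$, let $u$ be an input defined on $[0,\infty)$ such that $u(t)\to\bar{u}$ as $t\to\infty$, and let $x(\cdot)$ be a solution of $\dot{x}(t)=f(x(t),u(t))$ which is defined on $[0,\infty)$ and is $K$-recurrent. Then $x(t)\to\bar{x}$ as $t\to\infty$. (2) For each $\varepsilon>0$ there is some $\delta>0$ such that, for every $\xi\in\mathbb{X}$ with $|\xi|<\delta$ and every input $u$ defined on $[0,\infty)$ with $\|u\|<\delta$, the solution $x(t)=\varphi(t,\xi,u)$ exists for all $t\ge 0$, and $|x(t)|<\varepsilon$ for all $t\ge 0$.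
   Context: An input defined on an interval $\mathcal{I}\subseteq[0,\infty)$ is a Lebesgue-measurable function $u:\mathcal{I}\to\mathbb{U}$ which is locally essentially bounded in the sense that for each compact $\mathcal{I}_0\subseteq\mathcal{I}$ there is a compact $\mathbb{U}_0\subseteq\mathbb{U}$ with $u(t)\in\mathbb{U}_0$ for almost all $t\in\mathcal{I}_0$. Solutions of $\dot{x}(t)=f(x(t),u(t))$ are (locally) absolutely continuous functions with values in $\mathbb{X}$ satisfying the equation for almost all $t$. For an input $u$ defined on an interval containing $0$ and $\xi\in\mathbb{X}$, $\varphi(t,\xi,u)$ denotes the unique maximal solution (in forward time) with $x(0)=\xi$; when $u\equiv\bar{u}$ one writes $\varphi(t,\xi)$. Notation: for $\xi\in\mathbb{X}$, $|\xi|$ denotes the Euclidean distance from $\xi$ to $\bar{x}$; for $\mu\in\mathbb{U}$, $|\mu|$ denotes the distance from $\mu$ to $\bar{u}$; for an input $u:\mathcal{I}\to\mathbb{U}$, $\|u\|$ is the essential supremum of $|u(t)|$ over $t\in\mathcal{I}$. Asymptotically stable means stable in the sense of Lyapunov and locally attractive. The domain of attraction $\mathcal{O}$ is the set of all $\xi\in\mathbb{X}$ such that $\varphi(t,\xi)$ is defined for all $t\ge0$ and $\varphi(t,\xi)\to\bar{x}$ as $t\to\infty$; it is an open subset of $\mathbb{X}$. Given a compact $K\subseteq\mathbb{X}$, a function $x:[0,\infty)\to\mathbb{X}$ is $K$-recurrent if for each $T>0$ there is some $t>T$ such that $x(t)\in K$. *)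

(* Defs.v *)
From mathcomp Require Export all_boot all_order all_algebra.
From mathcomp Require Export all_classical all_reals all_analysis.
From mathcomp Require Export ess_sup_inf.
Set Implicit Arguments.
Unset Strict Implicit.
Unset Printing Implicit Defensive.
Import Order.TTheory GRing.Theory Num.Theory.
Import numFieldNormedType.Exports.
Local Open Scope classical_set_scope.
Local Open Scope ring_scope.

(* The library's norm on row vectors is the max norm. *)
Definition enorm (R : realType) (n : nat) (v : 'rV[R]_n) : R :=
  Num.sqrt (\sum_(i < n) v ord0 i ^+ 2).

Definition half_line (R : realType) : set R := [set t | 0 <= t].

(* The Caratheodory-measurable sets of the outer measure generated by interval
   length; by [completed_caratheodory_measurable] they form the completion of
   the Borel sigma-algebra. *)
Definition Lebesgue_measurable (R : realType) (A : set R) : Prop :=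
  ((@wlength R idfun)^*)%mu.-cara.-measurable A.

(* A function on a subset [I] of the line is represented by a total function
   whose values outside [I] are irrelevant. *)
Definition is_input (R : realType) (U : metricType R) (I : set R) (u : R -> U) :
    Prop :=
  (forall V : set U, open V -> Lebesgue_measurable (I `&` u @^-1` V)) /\
  (forall I0 : set R, I0 `<=` I -> compact I0 ->
     exists2 U0 : set U, compact U0 &
       {ae lebesgue_measure, forall t : R, I0 t -> U0 (u t)}).

(* [\_ I] extends by 0 outside [I], which does not affect the essential
   supremum over [I] of a nonnegative function. *)
Definition input_norm (R : realType) (U : metricType R) (ubar : U)
    (I : set R) (u : R -> U) : \bar R :=
  ess_sup (@lebesgue_measure R) ((fun t => (mdist (u t) ubar)%:E) \_ I).

Definition abs_continuous (R : realType) (n : nat) (a b : R)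
    (x : R -> 'rV[R]_n) : Prop :=
  forall e : R, 0 < e -> exists2 d : R, 0 < d &
    forall (m : nat) (s t : 'I_m -> R),
      (forall i, a <= s i /\ s i <= t i /\ t i <= b) ->
      trivIset [set: 'I_m] (fun i => `]s i, t i[%classic) ->
      \sum_(i < m) (t i - s i) < d ->
      \sum_(i < m) enorm (x (t i) - x (s i)) < e.

Definition locally_abs_continuous (R : realType) (n : nat) (J : set R)
    (x : R -> 'rV[R]_n) : Prop :=
  forall a b : R, a <= b -> `[a, b] `<=` J -> abs_continuous a b x.

Definition is_solution (R : realType) (n : nat) (U : metricType R)
    (X : set 'rV[R]_n) (f : 'rV[R]_n -> U -> 'rV[R]_n)
    (u : R -> U) (J : set R) (x : R -> 'rV[R]_n) : Prop :=
  [/\ forall t, J t -> X (x t),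
      locally_abs_continuous J x &
      {ae lebesgue_measure, forall t : R, J t ->
         is_derive t (1 : R) x (f (x t) (u t))}].

Definition is_forward_solution (R : realType) (n : nat) (U : metricType R)
    (X : set 'rV[R]_n) (f : 'rV[R]_n -> U -> 'rV[R]_n)
    (xi : 'rV[R]_n) (u : R -> U) (J : set R) (x : R -> 'rV[R]_n) : Prop :=
  [/\ is_interval J, J `<=` half_line (R:=R), J 0, x 0 = xi &
      is_solution X f u J x].

(* [x] on the interval [J] is the unique maximal forward solution
   [phi(., xi, u)], for an input [u] defined on [0, +oo[: every forward solution
   with the same initial value is a restriction of it. *)
Definition is_phi (R : realType) (n : nat) (U : metricType R)
    (X : set 'rV[R]_n) (f : 'rV[R]_n -> U -> 'rV[R]_n)
    (xi : 'rV[R]_n) (u : R -> U) (J : set R) (x : R -> 'rV[R]_n) : Prop :=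
  is_forward_solution X f xi u J x /\
  forall (J' : set R) (y : R -> 'rV[R]_n), is_forward_solution X f xi u J' y ->
    J' `<=` J /\ forall t, J' t -> y t = x t.

Definition locally_Lipschitz (R : realType) (n : nat) (U : metricType R)
    (X : set 'rV[R]_n) (f : 'rV[R]_n -> U -> 'rV[R]_n) : Prop :=
  forall (xi : 'rV[R]_n) (U0 : set U), X xi -> compact U0 ->
    exists (V : set 'rV[R]_n) (L : R),
      [/\ nbhs xi V, V `<=` X &
          forall x z u, V x -> V z -> U0 u ->
            enorm (f x u - f z u) <= L * enorm (x - z)].

Definition attraction_domain (R : realType) (n : nat) (U : metricType R)
    (X : set 'rV[R]_n) (f : 'rV[R]_n -> U -> 'rV[R]_n)
    (xbar : 'rV[R]_n) (ubar : U) : set 'rV[R]_n :=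
  [set xi | X xi /\ exists x : R -> 'rV[R]_n,
     is_phi X f xi (fun=> ubar) (half_line (R:=R)) x /\
     x t @[t --> +oo] --> xbar].

Definition Lyapunov_stable (R : realType) (n : nat) (U : metricType R)
    (X : set 'rV[R]_n) (f : 'rV[R]_n -> U -> 'rV[R]_n)
    (xbar : 'rV[R]_n) (ubar : U) : Prop :=
  forall e : R, 0 < e -> exists2 d : R, 0 < d &
    forall xi, X xi -> enorm (xi - xbar) < d ->
      exists x : R -> 'rV[R]_n,
        is_phi X f xi (fun=> ubar) (half_line (R:=R)) x /\
        forall t, 0 <= t -> enorm (x t - xbar) < e.

Definition locally_attractive (R : realType) (n : nat) (U : metricType R)
    (X : set 'rV[R]_n) (f : 'rV[R]_n -> U -> 'rV[R]_n)
    (xbar : 'rV[R]_n) (ubar : U) : Prop :=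
  exists2 d : R, 0 < d &
    forall xi, X xi -> enorm (xi - xbar) < d ->
      attraction_domain X f xbar ubar xi.

Definition asymptotically_stable (R : realType) (n : nat) (U : metricType R)
    (X : set 'rV[R]_n) (f : 'rV[R]_n -> U -> 'rV[R]_n)
    (xbar : 'rV[R]_n) (ubar : U) : Prop :=
  Lyapunov_stable X f xbar ubar /\ locally_attractive X f xbar ubar.

Definition recurrent (R : realType) (n : nat) (K : set 'rV[R]_n)
    (x : R -> 'rV[R]_n) : Prop :=
  forall T : R, 0 < T -> exists2 t : R, T < t & K (x t).

(* Main.v *)
Require Import Defs.
From HB Require Import structures.
From mathcomp Require Import measurable_realfun.
From mathcomp Require Import ring lra.
Set Implicit Arguments.
Unset Strict Implicit.
Unset Printing Implicit Defensive.
Import Order.TTheory GRing.Theory Num.Theory.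
Import numFieldNormedType.Exports.
Local Open Scope classical_set_scope.
Local Open Scope ring_scope.

(** Both parts rest on comparing a perturbed trajectory x, driven by an input u
that stays close to ubar, with an unperturbed trajectory y.

Around the compact arc y([0, T]) there is a tube on which f(., ubar) is
Lipschitz with one constant ([lipschitz_tube]) and f(., w) is uniformly close
to f(., ubar) for w near ubar ([rhs_uniform_in_input]).  As long as x stays in
the tube, |x' - y'| <= c + L |x - y| almost everywhere, and [gronwall] keeps x
in the tube if c and the initial gap are small.  Hence [tracking]: x follows y
on [0, T] within any prescribed distance, with a tolerance that depends on y
and T but serves all starting points near y(0).

Total stability ([total_stability]).  Choose d such that unperturbed
trajectories from the closed ball B of radius d stay within e/2 of xbar.  Each
of them is d/2-close to xbar at some time T >= 1, so by tracking every
perturbed trajectory starting near it stays within e of xbar up to time T and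
is then back in B.  Compactness of B gives one tolerance on the input for all
starting points, and returning to B again and again, at times at least 1 apart,
keeps the trajectory within e of xbar forever.

Part (1) ([recurrent_cvg]).  Late visits of x to K happen when u is already
close to ubar.  The unperturbed trajectory from a point of K converges to xbar,
so by tracking, and compactness of K, x enters the ball B of total stability
soon after such a visit, and stays within e of xbar from then on.

Part (2) ([stability_under_small_inputs]).  Trajectories must also be shown to
exist for all times.  Composing f with the clamping of the state to a small box
around xbar gives a bounded system that is Lipschitz in the state uniformly in
space; by Picard iteration it has global solutions for measurable inputs
([caratheodory_existence]).  Total stability applies to the clamped system,
since it has the same trajectories inside the box, and shows that its perturbed
solutions do not leave the box.  They therefore solve the original system.

Absolute continuity enters only through [mean_value_ineq]: if |g'| <= phi'
almost everywhere, then |g(b) - g(a)| <= phi(b) - phi(a).  Lebesgue integration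
enters only through [lipschitz_primitive]: a bounded measurable function is
almost everywhere the derivative of a Lipschitz function. *)

(** * Euclidean norm, maximum norm and slopes *)

Lemma subrACA (V : zmodType) (a b c d : V) : (a - b) - (c - d) = (a - c) - (b - d).
Proof. by rewrite !opprD !opprK addrACA. Qed.

Lemma dist_max (R : realDomainType) (a s t : R) : `|Num.max a s - Num.max a t| <= `|s - t|.
Proof.
have st := ler_norm (s - t); have ts := ler_norm (t - s); rewrite distrC in ts.
by rewrite ler_norml; case: (leP a s); case: (leP a t); lra.
Qed.

Lemma dist_min (R : realDomainType) (a s t : R) : `|Num.min a s - Num.min a t| <= `|s - t|.
Proof.
have st := ler_norm (s - t); have ts := ler_norm (t - s); rewrite distrC in ts.
by rewrite ler_norml; case: (leP a s); case: (leP a t); lra.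
Qed.

Section EuclideanNorm.
Variables (R : realType) (n : nat).
Implicit Types v : 'rV[R]_n.

Lemma coord_le_norm v i : `|v ord0 i| <= `|v|.
Proof.
rewrite [leRHS]/Num.Def.normr/= mx_normrE.
exact: (le_bigmax _ (fun k : 'I_1 * 'I_n => `|v k.1 k.2|) (ord0, i)).
Qed.

Lemma norm_le_coord v e : 0 <= e -> (forall i, `|v ord0 i| <= e) -> `|v| <= e.
Proof.
move=> e0 ve; rewrite [leLHS]/Num.Def.normr/= mx_normrE.
by apply: bigmax_le => // -[i j] _; rewrite (ord1 i).
Qed.

Lemma norm_le_enorm v : `|v| <= enorm v.
Proof.
apply: norm_le_coord => [|i]; first exact: sqrtr_ge0.
rewrite -sqrtr_sqr /enorm ler_wsqrtr// (bigD1 i)//= lerDl sumr_ge0// => j _.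
exact: sqr_ge0.
Qed.

Lemma enorm_le_norm v : enorm v <= Num.sqrt n%:R * `|v|.
Proof.
rewrite -[X in _ * X]ger0_norm// -sqrtr_sqr -sqrtrM// ler_wsqrtr//.
rewrite mulr_natl -[X in _ *+ X]card_ord -sumr_const ler_sum// => i _.
by rewrite -[leLHS]real_normK ?num_real// ler_sqr ?nnegrE// coord_le_norm.
Qed.

(** The denominator is positive in every dimension, including zero. *)
Lemma enorm_small v e :
  `|v| < e / (Num.sqrt n%:R + 1) -> enorm v < e.
Proof.
have n1 : 0 < Num.sqrt n%:R + 1 :> R by rewrite ltr_wpDl// sqrtr_ge0.
rewrite ltr_pdivlMr// mulrC; apply: le_lt_trans.
by apply: (le_trans (enorm_le_norm _)); rewrite ler_wpM2r// lerDl.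
Qed.

End EuclideanNorm.

Section Slopes.
Variables (R : realType) (V : normedModType R).
Implicit Types (g : R -> V) (t : R) (v : V).

(** The estimate form of differentiability.  It makes sense at s = t and for s on
both sides of t, so that estimates to the left and to the right can be added. *)
Lemma is_derive_slope g t v : is_derive t (1 : R) g v <->
  (forall e, 0 < e -> \forall s \near t, `|g s - g t - (s - t) *: v| <= e * `|s - t|).
Proof.
split=> [[gt <-] e e0|gv].
- move/cvgrPdist_le : gt => /(_ _ e0).
  rewrite -[lim _]/('D_1 g t) /dnbhs near_withinE => gt.
  have : \forall s \near t, s - t != 0 ->
     `|'D_1 g t - (s - t)^-1 *: (g ((s - t) *: (1:R) + t) - g t)| <= e.
    have : (s - t) @[s --> t] --> (0 : R).
      by rewrite -[X in _ --> X](subrr t); apply: cvgB; [exact: cvg_id|exact: cvg_cst].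
    by move=> /(_ _ gt).
  apply: filterS => s /=; have [->|st] := eqVneq s t.
    by move=> _; rewrite !subrr scale0r subr0 !normr0 mulr0.
  rewrite subr_eq0 => /(_ st); rewrite [_ *: 1]mulr1 subrK.
  have -> : g s - g t - (s - t) *: 'D_1 g t =
      - ((s - t) *: ('D_1 g t - (s - t)^-1 *: (g s - g t))).
    by rewrite scalerBr scalerA divff ?subr_eq0// scale1r opprB.
  by rewrite normrN normrZ mulrC => h; rewrite ler_wpM2r.
- have cvgv : h^-1 *: ((g \o shift t) (h *: (1:R)) - g t) @[h --> 0^'] --> v.
    apply/cvgrPdist_le => e e0.
    rewrite /dnbhs near_withinE.
    have : \forall h \near (0:R), `|g (h + t) - g t - (h + t - t) *: v| <= e * `|h + t - t|.
      have : (h + t) @[h --> (0:R)] --> t.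
        by rewrite -[X in _ --> X](add0r t); apply: cvgD; [exact: cvg_id|exact: cvg_cst].
      by move=> /(_ _ (gv e e0)).
    apply: filterS => h /= + h0.
    rewrite addrK [_ *: 1]mulr1.
    have -> : v - h^-1 *: (g (h + t) - g t) =
        - (h^-1 *: (g (h + t) - g t - h *: v)).
      by rewrite [in RHS]scalerBr scalerA mulVf// scale1r opprB.
    by rewrite normrN normrZ normfV ler_pdivrMl ?normr_gt0// mulrC.
  split; first by apply/cvg_ex; exists v.
  exact/cvg_lim.
Qed.

End Slopes.

(** * A mean value inequality for absolutely continuous functions *)

(** Induction along an interval with a gauge: it is enough that near each point t
the property passes from the left of t to the right of t across short intervals.
The point to consider is the supremum of the set where the property holds. *)
Lemma gauge_induction (R : realType) (a b : R) (P : R -> Prop) : a <= b -> P a ->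
  (forall t, a <= t <= b -> exists2 d, 0 < d & forall x y,
     a <= x <= t -> t <= y <= b -> y - x < d -> P x -> P y) ->
  P b.
Proof.
move=> ab Pa step; pose S := [set x | a <= x <= b /\ P x].
have Sa : S a by rewrite /S /= lexx ab.
have supS : has_sup S by split; [exists a|exists b => x [/andP[]]].
have aS : a <= sup S by apply: ub_le_sup => //; exact: supS.2.
have Sb : sup S <= b by apply: ge_sup; [exists a|move=> x [/andP[]]].
have [|d d0 Pd] := step (sup S); first by rewrite aS.
have [x [/andP[ax xb] Px] xS] := sup_adherent d0 supS.
have xleS : x <= sup S by apply: ub_le_sup; [exact: supS.2|split; rewrite ?ax].
have d2 : 0 < d - (sup S - x) by lra.
pose y := Num.min b (sup S + (d - (sup S - x)) / 2).
have Sy : sup S <= y by rewrite /y le_min Sb/=; lra.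
have yx : y <= sup S + (d - (sup S - x)) / 2 by rewrite /y ge_min lexx orbT.
have yb : y <= b by rewrite /y ge_min lexx.
have Py : P y by apply: (Pd x) => //; [rewrite ax|rewrite Sy|lra].
have yS : y <= sup S.
  by apply: ub_le_sup; [exact: supS.2|split=> //; rewrite yb andbT (le_trans aS)].
move: yS; rewrite {1}/y ge_min => /orP[bS|]; last by lra.
by have -> : b = y by apply/eqP; rewrite eq_le yb andbT (le_trans bS).
Qed.

Section AbsolutelyContinuous.
Variable R : realType.

(** Finite families of intervals listed from left to right.  In this form a family
is extended by one interval on its right without any bookkeeping, which is how
the proof of the mean value inequality builds one. *)
Definition chain (a b : R) (m : nat) (s t : nat -> R) : Prop :=
  (forall i, (i < m)%N -> [/\ a <= s i, s i <= t i & t i <= b]) /\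
  (forall i j, (i < j < m)%N -> t i <= s j).

Definition snoc (m : nat) (s : nat -> R) (x : R) : nat -> R :=
  fun i => if i == m then x else s i.

Lemma chain_snoc a x y m s t : a <= x -> x <= y -> chain a x m s t ->
  chain a y m.+1 (snoc m s x) (snoc m t y).
Proof.
move=> ax xy [st ord]; split=> [i|i j /andP[ij]]; rewrite ltnS leq_eqVlt /snoc.
  have [-> _|_ /=] := eqVneq i m; first by split.
  by move=> /st[? ? tx]; split=> //; exact: le_trans xy.
have [jm _|_ /= jm] := eqVneq j m.
  by rewrite -jm (ltn_eqF ij); have [|_ _] := st i; first by rewrite -jm.
by rewrite (ltn_eqF (ltn_trans ij jm)); apply: ord; rewrite ij.
Qed.

Lemma sum_snoc (F : R -> R -> R) m s t x y :
  \sum_(i < m.+1) F (snoc m s x i) (snoc m t y i) =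
  \sum_(i < m) F (s i) (t i) + F x y.
Proof.
rewrite big_ord_recr/= /snoc eqxx; congr (_ + _).
by apply: eq_bigr => i _; rewrite ltn_eqF.
Qed.

(** Absolute continuity in any normed space.  For row vectors with the maximum norm
it follows from the version with Euclidean norms and disjoint families. *)
Definition ac (V : normedModType R) (a b : R) (g : R -> V) : Prop :=
  forall e : R, 0 < e -> exists2 d : R, 0 < d &
    forall (m : nat) (s t : nat -> R),
      chain a b m s t ->
      \sum_(i < m) (t i - s i) < d ->
      \sum_(i < m) `|g (t i) - g (s i)| < e.

Lemma abs_continuous_ac n (a b : R) (x : R -> 'rV[R]_n) :
  abs_continuous a b x -> ac a b x.
Proof.
move=> acx e e0; have [d d0 xd] := acx e e0; exists d => // m s t [st ord] std.
have {}xd := xd m (fun i => s i) (fun i => t i).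
apply: le_lt_trans (xd _ _ std).
- by apply: ler_sum => i _; exact: norm_le_enorm.
- by move=> i; have [] := st i (ltn_ord i).
- apply/trivIsetP => /= i j _ _ ij; wlog {ij} ij : i j / (i < j)%N => [w|].
    have [/w//|ji|/val_inj ij'] := ltngtP i j; last by rewrite ij' eqxx in ij.
    by rewrite setIC; exact: w.
  apply/seteqP; split=> // z /=; rewrite !in_itv/= => -[/andP[_ zt] /andP[sz _]].
  by have := ord i j; rewrite ij ltn_ord => /(_ isT); lra.
Qed.

Lemma lipschitz_abs_continuous n (a b M : R) (x : R -> 'rV[R]_n) :
  (forall s t, a <= s -> s <= t -> t <= b -> `|x t - x s| <= M * (t - s)) ->
  abs_continuous a b x.
Proof.
move=> xM e e0; pose N := Num.sqrt n%:R * `|M| + 1.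
have N0 : 0 < N by rewrite ltr_wpDl// mulr_ge0// sqrtr_ge0.
exists (e / N); first exact: divr_gt0.
move=> m s t st _; rewrite ltr_pdivlMr// mulrC => std.
apply: le_lt_trans std; rewrite mulr_sumr ler_sum// => i _.
have [si [sti ti]] := st i.
apply: le_trans (enorm_le_norm _) _.
apply: (@le_trans _ _ (Num.sqrt n%:R * (`|M| * (t i - s i)))).
  rewrite ler_wpM2l ?sqrtr_ge0// (le_trans (xM _ _ _ _ _))//.
  by rewrite ler_wpM2r ?subr_ge0// ler_norm.
by rewrite mulrA ler_wpM2r ?subr_ge0// /N lerDl.
Qed.

Variable V : normedModType R.
Implicit Types (g h : R -> V).

Lemma acB a b g h : ac a b g -> ac a b h -> ac a b (g - h).
Proof.
move=> acg ach e e0; have e2 : 0 < e / 2 by rewrite divr_gt0.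
have [d d0 gd] := acg _ e2; have [d' d'0 hd] := ach _ e2.
exists (Num.min d d'); first by rewrite lt_min d0.
move=> m s t st; rewrite lt_min => /andP[std std'].
have {}gd := gd m s t st std; have {}hd := hd m s t st std'.
apply: le_lt_trans (_ : \sum_(i < m) (`|g (t i) - g (s i)| + `|h (t i) - h (s i)|) < _).
  apply: ler_sum => i _; rewrite -[(g - h) (t i)]/(g (t i) - h (t i)).
  rewrite -[(g - h) (s i)]/(g (s i) - h (s i)).
  rewrite subrACA; exact: ler_normB.
by rewrite big_split/=; lra.
Qed.

Lemma ac_shift a b c g : ac a b g -> ac (a + c) (b + c) (fun t => g (t - c)).
Proof.
move=> acg e e0; have [d d0 gd] := acg _ e0; exists d => // m s t [st ord] std.
apply: (gd m (fun i => s i - c) (fun i => t i - c)).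
- split=> [i /st[? ? ?]|i j /ord]; last by lra.
  by split; lra.
- by under eq_bigr do rewrite opprB addrA subrK.
Qed.

Lemma ac_sub a b a' b' g : a <= a' -> b' <= b -> ac a b g -> ac a' b' g.
Proof.
move=> aa bb acg e e0; have [d d0 gd] := acg _ e0; exists d => // m s t [st ord].
by apply: gd; split=> // i /st[? ? ?]; split; lra.
Qed.

Lemma ac_unif a b g : ac a b g -> forall e, 0 < e -> exists2 d, 0 < d &
  forall s t, a <= s -> s <= t -> t <= b -> t - s < d -> `|g t - g s| < e.
Proof.
move=> acg e e0; have [d d0 gd] := acg _ e0; exists d => // s t as_ st tb std.
have := gd 1%N (fun=> s) (fun=> t).
rewrite !big_ord1; apply=> //; split=> // i j /andP[ij]; rewrite ltnS leqn0 => /eqP j0.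
by rewrite j0 in ij.
Qed.

(** The interval [x, y] only has to contain t: the errors of the two linear
approximations at t add up to at most e (y - t) + e (t - x) for each function. *)
Lemma slopes_straddle g (phi : R -> R) t v w e x y : x <= t -> t <= y -> `|v| <= w ->
  `|g x - g t - (x - t) *: v| <= e * `|x - t| ->
  `|g y - g t - (y - t) *: v| <= e * `|y - t| ->
  `|phi x - phi t - (x - t) *: w| <= e * `|x - t| ->
  `|phi y - phi t - (y - t) *: w| <= e * `|y - t| ->
  `|g y - g x| <= phi y - phi x + 2 * e * (y - x).
Proof.
move=> xt ty vw gx gy phix phiy.
have txE : `|x - t| = t - x by rewrite ler0_norm ?opprB// subr_le0.
have tyE : `|y - t| = y - t by rewrite ger0_norm ?subr_ge0.
rewrite txE in gx phix; rewrite tyE in gy phiy.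
have gxy : `|g y - g x| <= w * (y - x) + e * (y - x).
  have -> : g y - g x = (y - x) *: v +
     ((g y - g t - (y - t) *: v) - (g x - g t - (x - t) *: v)).
    have -> : (y - x) *: v = (y - t) *: v - (x - t) *: v.
      by rewrite -scalerBl opprB addrA subrK.
    rewrite subrACA (subrACA (g y)) subrr subr0.
    by rewrite [RHS]addrC subrK.
  apply: (le_trans (ler_normD _ _)); apply: lerD.
    by rewrite normrZ ger0_norm ?subr_ge0 1?mulrC ?ler_wpM2r ?subr_ge0//; lra.
  apply: (le_trans (ler_normB _ _)); apply: (le_trans (lerD gy gx)).
  by rewrite -mulrDr addrA subrK.
have phixy : w * (y - x) - e * (y - x) <= phi y - phi x.
  have := le_trans (ler_norm _) phix; rewrite -[_ *: w]/((x - t) * w).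
  rewrite -normrN in phiy.
  have := le_trans (ler_norm _) phiy; rewrite -[_ *: w]/((y - t) * w).
  by clear; lra.
by lra.
Qed.

(** Points where the derivative is missing lie in a null set N, which is covered by
an open set W of small measure.  Walking from a to b by gauge induction, a short
step around a point outside W costs at most the growth of phi plus a small slope
error, and a short step around a point of W can be taken inside W.  The steps
inside W form a chain of total length at most the measure of W, so by absolute
continuity their contribution is small. *)
Lemma mean_value_ineq a b g (phi : R -> R) : a <= b -> ac a b g ->
  (forall s t, a <= s -> s <= t -> t <= b -> phi s <= phi t) ->
  {ae @lebesgue_measure R, forall t, a <= t <= b ->
     exists v w, [/\ is_derive t (1 : R) g v, is_derive t (1 : R) phi w & `|v| <= w]} ->
  `|g b - g a| <= phi b - phi a.
Proof.
move=> ab acg phile [N [mN N0 aeN]].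
(* the first error comes from the slopes, the second from the steps in W *)
suff H e : 0 < e -> `|g b - g a| <= phi b - phi a + e * (b - a) + e.
  apply/ler_addgt0Pr => e e0; have e1 : 0 < e / (b - a + 1) by rewrite divr_gt0; lra.
  apply: (le_trans (H _ e1)); rewrite -addrA lerD2l -[X in _ + X]mulr1 -mulrDr.
  by rewrite divfK//; lra.
move=> e0; have [d d0 gd] := acg _ e0.
have muNoo : (lebesgue_measure N < +oo)%E by rewrite N0.
have [W [oW NW muW]] := lebesgue_regularity_outer mN muNoo d0.
have mW : measurable W by exact: open_measurable.
have muWd : (lebesgue_measure W < d%:E)%E.
  by rewrite -(setDUK NW) setUC measureU0//; exact: measurableD.
pose P c := exists m (s t : nat -> R),
  [/\ chain a c m s t,
      ((\sum_(i < m) (t i - s i))%:E <= lebesgue_measure (W `&` `[a, c[))%E &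
      `|g c - g a| <= phi c - phi a + e * (c - a) + \sum_(i < m) `|g (t i) - g (s i)|].
have [m [s [t [st len ineq]]]] : P b.
  apply: (gauge_induction ab).
    exists 0%N, (fun=> 0), (fun=> 0); split=> //.
    + by rewrite big_ord0 measure_ge0.
    + by rewrite big_ord0 !subrr normr0 mulr0 !addr0.
  move=> t /andP[at_ tb]; have [Wt|Wt] := pselect (W t).
    (* the step from x to y is added to the chain *)
    have [r /= r0 rW] := (nbhs_ballP _ _).1 (open_nbhs_nbhs (conj oW Wt)).
    exists r => // x y /andP[ax xt] /andP[ty yb] yx [m [p [q [pq len ineq]]]].
    have xy : x <= y := le_trans xt ty.
    exists m.+1, (snoc m p x), (snoc m q y); split.
    - exact: chain_snoc.
    - rewrite (sum_snoc (fun u v => v - u)) EFinD.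
      have -> : W `&` `[a, y[ = (W `&` `[a, x[) `|` `[x, y[.
        clear - ax xt ty yx rW xy; apply/seteqP; split=> z /=; rewrite !in_itv/=.
          by move=> [Wz /andP[az zy]]; have [zx|zx] := ltP z x; [left|right]; rewrite ?az.
        move=> [[Wz /andP[az zx]]|/andP[xz zy]]; first by rewrite az (lt_le_trans zx).
        split; last by rewrite zy (le_trans ax).
        by apply: rW; rewrite /ball/= ltr_norml; lra.
      rewrite measureU//; last 2 first.
      + exact: measurableI.
      + apply/seteqP; split=> // z /=; rewrite !in_itv/= => -[[_ /andP[_ zx]]].
        by rewrite leNgt zx.
      have := lebesgue_measure_itv `[x, y[; rewrite /= lte_fin => muxy.
      apply: leeD => //; rewrite [leRHS]muxy.
      by case: ltP => // yx'; rewrite lee_fin subr_le0.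
    - rewrite (sum_snoc (fun u v => `|g v - g u|)) addrA.
      have phixy : phi x <= phi y by apply: phile.
      have exy : e * (x - a) <= e * (y - a) by rewrite ler_pM2l// lerB.
      have := ler_normD (g y - g x) (g x - g a); rewrite subrKA.
      by clear - ineq phixy exy; lra.
  have [v [w [gv phiw vw]]] : exists v w,
      [/\ is_derive t (1 : R) g v, is_derive t (1 : R) phi w & `|v| <= w].
    apply: contrapT => H; apply: Wt; apply: NW; apply: aeN => /= K; apply: H.
    by apply: K; rewrite at_.
  have e2 : 0 < e / 2 by rewrite divr_gt0.
  have /is_derive_slope/(_ _ e2)gt := gv.
  have /is_derive_slope/(_ _ e2)phit := phiw.
  have [r /= r0 rgt] := (nbhs_ballP _ _).1 (filterI gt phit).
  exists r => // x y /andP[ax xt] /andP[ty yb] yx [m [p [q [[pq ord] len ineq]]]].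
  have xy : x <= y := le_trans xt ty.
  exists m, p, q; split=> //.
  - split=> // i /pq[? ? ?]; split=> //; exact: le_trans xy.
  - apply: (le_trans len); apply: le_measure; rewrite ?inE; [exact: measurableI..|].
    move=> z /=; rewrite !in_itv/= => -[Wz /andP[az zx]]; split=> //.
    by rewrite az (lt_le_trans zx).
  have rx : ball t r x by clear - xt ty yx; rewrite /ball/= ltr_norml; lra.
  have ry : ball t r y by clear - xt ty yx; rewrite /ball/= ltr_norml; lra.
  have [gx phix] := rgt _ rx; have [gy phiy] := rgt _ ry.
  have := slopes_straddle xt ty vw gx gy phix phiy.
  have := ler_normD (g y - g x) (g x - g a); rewrite subrKA.
  by clear - ineq; lra.
apply: (le_trans ineq); rewrite lerD2l ltW//; apply: (gd m s t) => //.
rewrite -lte_fin; apply: le_lt_trans muWd; apply: (le_trans len).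
by apply: le_measure; rewrite ?inE//; exact: measurableI.
Qed.

End AbsolutelyContinuous.

(** * A local Gronwall inequality *)

Section Gronwall.
Variables (R : realType) (V : normedModType R).
Implicit Types g : R -> V.

Lemma is_derive_scaled_exp (c K a t : R) :
  is_derive t (1 : R) (fun s => c * expR (K * (s - a))) (K * (c * expR (K * (t - a)))).
Proof.
have dlin : is_derive t (1 : R) (fun s : R => K * (s - a)) K.
  have -> : (fun s : R => K * (s - a)) = K \*: (id - cst a) by [].
  by apply: is_derive_eq; rewrite subr0 [_ *: _]mulr1.
have := is_deriveZ c (is_derive1_comp (is_derive_expR _) dlin).
by move/is_derive_eq; apply; rewrite -[LHS]/(c * (expR (K * (t - a)) * K)); ring.
Qed.

(** A single constant c bounds both the initial value and the forcing term.  Since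
psi(t) = c exp((L + 1) (t - a)) is at least c, it satisfies psi' >= c + L psi.
The differential inequality is assumed only where |g| < r, and psi stays at
most r.  The induction carries |g| <= psi - (c - |g(a)|), whose fixed margin
lets |g| < psi persist over steps of uniform length. *)
Lemma gronwall a b g L c r : a <= b -> ac a b g -> 0 <= L -> `|g a| < c ->
  c * expR ((L + 1) * (b - a)) <= r ->
  {ae @lebesgue_measure R, forall t, a <= t <= b -> `|g t| < r ->
     exists2 v, is_derive t (1 : R) g v & `|v| <= c + L * `|g t|} ->
  forall t, a <= t <= b -> `|g t| < c * expR ((L + 1) * (t - a)).
Proof.
move=> ab acg L0 gac psir aeg; have c0 : 0 < c by exact: le_lt_trans gac.
pose psi t := c * expR ((L + 1) * (t - a)).
have psi_le s t : s <= t -> psi s <= psi t.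
  by move=> st; rewrite ler_pM2l// ler_expR ler_wpM2l ?addr_ge0// lerD2r.
have psia : psi a = c by rewrite /psi subrr mulr0 expR0 mulr1.
pose Q t := forall s, a <= s <= t -> `|g s| <= `|g a| + psi s - psi a.
suff Qb : Q b.
  move=> t tab; apply: le_lt_trans (Qb t tab) _.
  by rewrite psia -[X in _ < X]/(psi t); lra.
have e0 : 0 < (c - `|g a|) / 2 by rewrite divr_gt0// subr_gt0.
have [d d0 gd] := ac_unif acg e0.
apply: (gauge_induction ab).
  by move=> s; rewrite -eq_le => /eqP <-; rewrite addrK.
move=> t _; exists d => // x y /andP[ax xt] /andP[ty yb] yx Qx.
have xy : x <= y := le_trans xt ty.
have gpsi s : a <= s -> s <= y -> `|g s| < psi s.
  move=> as_ sy; have [sx|/ltW xs] := leP s x.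
    have /Qx : a <= s <= x by rewrite as_.
    by clear - gac psia; lra.
  have gsx : `|g s - g x| < (c - `|g a|) / 2.
    by apply: gd => //; [exact: le_trans yb|apply: le_lt_trans yx; rewrite lerB].
  have gx : `|g x| <= `|g a| + psi x - psi a by apply: Qx; rewrite ax lexx.
  have gs : `|g s| <= `|g s - g x| + `|g x|.
    by rewrite -{1}(subrK (g x) (g s)) ler_normD.
  have := psi_le _ _ xs.
  by move: gsx gx gs gac; rewrite psia; clear; lra.
move=> s /andP[as_ sy].
have acgs : ac a s g by apply: ac_sub acg => //; exact: le_trans yb.
suff : `|g s - g a| <= psi s - psi a.
  have : `|g s| <= `|g s - g a| + `|g a|.
    by rewrite -{1}(subrK (g a) (g s)) ler_normD.
  by clear; lra.
apply: mean_value_ineq => //; first by move=> ? ? _ + _; exact: psi_le.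
apply: filterS aeg; first exact: (ae_filter_ringOfSetsType (@lebesgue_measure R)).
move=> t' /= gt' /andP[at' t's].
have t'y := le_trans t's sy; have t'b := le_trans t'y yb.
have [||v gv vle] := gt'; first by rewrite at'.
  apply: lt_le_trans (gpsi _ at' t'y) _; apply: le_trans psir.
  by apply: psi_le.
exists v, ((L + 1) * psi t'); split=> //; first exact: is_derive_scaled_exp.
apply: (le_trans vle); rewrite mulrDl mul1r addrC lerD//.
  by rewrite ler_wpM2l// ltW// gpsi.
by rewrite -psia psi_le.
Qed.

End Gronwall.

(** * Almost everywhere statements and translations *)

Section AlmostEverywhere.
Variable R : realType.
Implicit Types (P Q : R -> Prop).
Notation mu := (@lebesgue_measure R).

Lemma ae_imply P Q : (forall t, P t -> Q t) ->
  {ae mu, forall t, P t} -> {ae mu, forall t, Q t}.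
Proof. by move=> PQ; apply: filterS => //; exact: (ae_filter_ringOfSetsType mu). Qed.

Lemma ae_and P Q : {ae mu, forall t, P t} -> {ae mu, forall t, Q t} ->
  {ae mu, forall t, P t /\ Q t}.
Proof. by apply: filterI; exact: (ae_filter_ringOfSetsType mu). Qed.

Definition translation (c : R) : measurableTypeR R -> measurableTypeR R :=
  fun t => t - c.

Lemma measurable_translation c : measurable_fun [set: measurableTypeR R] (translation c).
Proof. exact: measurable_funB. Qed.

HB.instance Definition _ c := isMeasurableFun.Build _ _ _ _ (translation c)
  (measurable_translation c).

Lemma lebesgue_measure_shift (c : R) (A : set R) : measurable A ->
  mu (translation c @^-1` A) = mu A.
Proof.
move=> mA; apply/esym.
apply: (@lebesgue_measure_unique _ (pushforward mu (translation c))) => //.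
move=> _ /ocitvP[->|[[a b] /= ab ->]]; first by rewrite !measure0.
rewrite /pushforward lebesgue_measure_itv/= lte_fin ab.
have -> : translation c @^-1` `]a, b] = `]a + c, b + c]%classic.
  by apply/seteqP; split=> t; rewrite /translation /= !in_itv/= ltrBrDr lerBlDr.
rewrite lebesgue_measure_itv/= lte_fin ltrD2r ab -!EFinB; congr (_%:E).
by rewrite opprD addrACA subrr addr0.
Qed.

(** A trajectory followed from time 0 and one followed from time a are compared
after a translation in time. *)
Lemma ae_shift c P : {ae mu, forall t, P t} -> {ae mu, forall t, P (t - c)}.
Proof.
move=> [N [mN N0 PN]]; exists (translation c @^-1` N); split.
- rewrite -[X in measurable X]setTI.
  exact: (measurable_translation c _ mN).
- by rewrite lebesgue_measure_shift.
- by move=> t /= Pt; apply: PN.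
Qed.

End AlmostEverywhere.

(** * Uniform estimates on compact sets of states *)

Section Dynamics.
Variables (R : realType) (n : nat) (U : metricType R).
Variables (X : set 'rV[R]_n) (f : 'rV[R]_n -> U -> 'rV[R]_n).
Notation mu := (@lebesgue_measure R).
Hypothesis openX : open X.
Hypothesis f_continuous :
  {within X `*` [set: U], continuous (fun p : 'rV[R]_n * U => f p.1 p.2)}.
Hypothesis f_lipschitz : locally_Lipschitz X f.
Implicit Types (p q : 'rV[R]_n) (v : U) (u : R -> U) (x y : R -> 'rV[R]_n).

Lemma near_rhs p v e : X p -> 0 < e ->
  \forall q \near p & w \near v, `|f q w - f p v| < e.
Proof.
move=> Xp e0.
have /(_ (p, v)) := (subspace_continuousP _ _).1 f_continuous.
move=> /(_ (conj Xp I))/cvgrPdist_lt/(_ e e0).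
rewrite near_withinE => H.
have XT : \forall q \near p & w \near v, (X `*` [set: U]) (q, w).
  exists (X, setT); first by split; [exact: open_nbhs_nbhs|exact: filterT].
  by move=> [q w] [].
have : nbhs (p, v) [set qw | (X `*` [set: U]) qw] by exact: XT.
move=> /(filterI H); apply: filterS => -[q w] /= [h1 h2].
by rewrite distrC; apply: h1.
Qed.

(** Continuity at (p, v), applied at (q, w) and at (q, v), bounds the gap near p;
compactness of N makes the neighbourhood of v the same for all p. *)
Lemma rhs_uniform_in_input (N : set 'rV[R]_n) v e : compact N -> N `<=` X -> 0 < e ->
  exists2 d, 0 < d & forall p w, N p -> mdist w v < d -> `|f p w - f p v| <= e.
Proof.
move=> cN NX e0; have e2 : 0 < e / 2 by rewrite divr_gt0.
have /near_covering_withinP cov := (compact_near_coveringP _).1 cN.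
have /nbhs_ballP[d /= d0 dv] :
    \forall w \near v, N `<=` (fun w p => `|f p w - f p v| <= e) w.
  apply: cov => p Np.
  have := near_rhs v (NX _ Np) e2 => -[[A B] /= [Ap Bv] AB].
  exists (A, B) => // -[q w] /= [Aq Bw] _.
  rewrite -(subrK (f p v) (f q w)) -addrA.
  rewrite (le_trans (ler_normD _ _))// (splitr e) ltW// ltrD//.
    exact: (AB (q, w)).
  by rewrite distrC; apply: (AB (q, v)); split=> //=; exact: nbhs_singleton.
exists d => // p w Np wd; apply: dv => //=.
by rewrite ballEmdist /= metric_sym.
Qed.

(** Each point of C has a ball and a Lipschitz constant; covering C turns them into
one radius and one constant.  A single parameter i going to infinity plays both
parts, as the constant i and as the radius 1/i. *)
Lemma lipschitz_tube (C : set 'rV[R]_n) (U0 : set U) : compact C -> C `<=` X ->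
  compact U0 -> exists r L, [/\ 0 < r, 0 <= L &
    forall p q, C p -> `|q - p| < r ->
      X q /\ forall w, U0 w -> `|f q w - f p w| <= L * `|q - p|].
Proof.
move=> cC CX cU0.
have /near_covering_withinP cov := (compact_near_coveringP _).1 cC.
have [M [Mreal HM]] : \forall i \near pinfty_nbhs R, C `<=` (fun i p =>
    forall q, `|q - p| < i^-1 ->
      X q /\ forall w, U0 w -> `|f q w - f p w| <= i * `|q - p|) i.
  apply: cov => p Cp.
  have [V [L [Vp VX VL]]] := f_lipschitz (CX _ Cp) cU0.
  have [r /= r0 rV] := (nbhs_ballP _ _).1 Vp.
  have r2 : 0 < r / 2 by rewrite divr_gt0.
  exists (ball p (r / 2), [set i | (r / 2)^-1 < i /\ `|L| * Num.sqrt n%:R < i]) => /=.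
    split; first by apply/nbhs_ballP; exists (r / 2).
    by apply: filterI; apply: nbhs_pinfty_gt; exact: num_real.
  move=> [q i] /= [pq [ri Li]] Cq q' qq'.
  rewrite -ball_normE /ball_/= in pq.
  have i0 : 0 < i by apply: lt_trans ri; rewrite invr_gt0.
  have ir : i^-1 < r / 2 by rewrite -[ltRHS]invrK ltf_pV2 ?posrE ?invr_gt0.
  have Vq : V q.
    apply: rV; rewrite -ball_normE /ball_/=; apply: (lt_trans pq).
    by rewrite ltr_pdivrMr// ltr_pMr// ltrDl.
  have Vq' : V q'.
    apply: rV; rewrite -ball_normE /ball_/= -(subrK q p) -addrA.
    rewrite (le_lt_trans (ler_normD _ _))// (splitr r) ltrD// distrC.
    exact: lt_trans ir.
  split=> [|w Uw]; first exact: VX.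
  apply: (le_trans (norm_le_enorm _)); apply: (le_trans (VL _ _ _ Vq' Vq Uw)).
  apply: (@le_trans _ _ (`|L| * enorm (q' - q))).
    by rewrite ler_wpM2r ?sqrtr_ge0// ler_norm.
  apply: (@le_trans _ _ (`|L| * (Num.sqrt n%:R * `|q' - q|))).
    by rewrite ler_wpM2l// enorm_le_norm.
  by rewrite mulrA ler_wpM2r// ltW.
pose i := Num.max (M + 1) 1.
have i1 : 1 <= i by rewrite le_max lexx orbT.
have i0 : 0 < i by exact: lt_le_trans i1.
exists i^-1, i; rewrite invr_gt0 i0 ltW//; split=> // p q Cp; apply: (HM i) => //.
by rewrite lt_max ltrDl ltr01.
Qed.

End Dynamics.

(** * Comparison of solutions *)

Lemma compact_closed_ball (R : realType) (n : nat) (p : 'rV[R]_n) r :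
  compact [set q | `|q - p| <= r].
Proof.
apply: bounded_closed_compact.
  exists (r + `|p|); split; first exact: num_real.
  move=> M rM q /= qp; rewrite -(subrK p q); apply: (le_trans (ler_normD _ _)).
  by apply: le_trans (ltW rM); rewrite lerD2r.
have -> : [set q | `|q - p| <= r] = closed_ball_ (fun v => `|v|) p r.
  by apply/seteqP; split=> q; rewrite /closed_ball_/= distrC.
exact: closed_closed_ball_.
Qed.

Lemma compact_neighbourhood (R : realType) (n : nat) (C : set 'rV[R]_n) r :
  compact C -> compact [set q | exists2 p, C p & `|q - p| <= r].
Proof.
move=> cC; have -> : [set q | exists2 p, C p & `|q - p| <= r] =
    (fun z : 'rV[R]_n * 'rV[R]_n => z.1 + z.2) @` (C `*` [set q | `|q - 0| <= r]).
  apply/seteqP; split=> q /=.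
    move=> [p Cp qp]; exists (p, q - p) => /=; last by rewrite addrC subrK.
    by rewrite subr0.
  move=> [[p s] /= [Cp]]; rewrite subr0 => sr <-; exists p => //.
  by rewrite addrC addKr.
apply: continuous_compact; last by apply: compact_setX => //; exact: compact_closed_ball.
apply: continuous_subspaceT; exact: add_continuous.
Qed.

Lemma ac_curve_compact (R : realType) (V : normedModType R) a b (g : R -> V) :
  ac a b g -> compact (g @` `[a, b]).
Proof.
move=> acg; apply: continuous_compact; last exact: segment_compact.
apply/subspace_continuousP => t /=; rewrite in_itv/= => /andP[at_ tb].
apply/cvgrPdist_lt => e e0; have [d d0 gd] := ac_unif acg e0.
rewrite near_withinE; apply/nbhs_ballP; exists d => //= s.
rewrite /ball/= => sd; rewrite in_itv/= => /andP[as_ sb].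
have [ts|/ltW st] := leP t s.
  rewrite distrC; apply: gd => //; apply: le_lt_trans sd.
  by rewrite distrC ler_norm.
by apply: gd => //; apply: le_lt_trans sd; rewrite ler_norm.
Qed.

Section Comparison.
Variables (R : realType) (n : nat) (U : metricType R).
Variables (X : set 'rV[R]_n) (f : 'rV[R]_n -> U -> 'rV[R]_n).
Notation mu := (@lebesgue_measure R).
Implicit Types (p q : 'rV[R]_n) (v : U) (u w : R -> U) (x y : R -> 'rV[R]_n).

(** Solutions on a compact interval, where all the comparisons take place. *)
Definition solves u a b x : Prop :=
  [/\ forall t, a <= t <= b -> X (x t), ac a b x &
      {ae mu, forall t, a <= t <= b -> is_derive t (1 : R) x (f (x t) (u t))}].

Lemma is_solution_solves u J x a b : a <= b -> `[a, b] `<=` J ->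
  is_solution X f u J x -> solves u a b x.
Proof.
move=> ab abJ [xX acx dx]; split.
- by move=> t tab; apply: xX; apply: abJ; rewrite /= in_itv.
- by apply: abs_continuous_ac; exact: acx.
- apply: ae_imply dx => t dx tab; apply: dx.
  by apply: abJ; rewrite /= in_itv.
Qed.

Lemma solves_shift u a b c x : solves u a b x ->
  solves (fun t => u (t - c)) (a + c) (b + c) (fun t => x (t - c)).
Proof.
move=> [xX acx dx]; split.
- by move=> t /andP[? ?]; apply: xX; rewrite lerBrDr lerBlDr; apply/andP.
- exact: ac_shift.
- apply: ae_imply (ae_shift c dx) => t {}dx /andP[? ?].
  have {dx} : is_derive (t - c) (1 : R) x (f (x (t - c)) (u (t - c))).
    by apply: dx; rewrite lerBrDr lerBlDr; apply/andP.
  move=> /is_derive_slope dx; apply/is_derive_slope => e e0.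
  have : (s - c) @[s --> t] --> t - c by apply: cvgB; [exact: cvg_id|exact: cvg_cst].
  move=> /(_ _ (dx e e0)) {}dx.
  have : \forall s \near t, `|x (s - c) - x (t - c) -
      (s - c - (t - c)) *: f (x (t - c)) (u (t - c))| <= e * `|s - c - (t - c)| by [].
  apply: filterS => s.
  by have -> : s - c - (t - c) = s - t by rewrite opprB addrA subrK.
Qed.

(** The radius r makes this local: the right-hand sides are compared only at points
that are r-close to the reference solution y. *)
Lemma solutions_close u w a b x y c L r : a <= b ->
  solves u a b x -> solves w a b y -> 0 <= L ->
  `|x a - y a| < c -> c * expR ((L + 1) * (b - a)) <= r ->
  {ae mu, forall t, a <= t <= b -> forall q, `|q - y t| < r ->
     `|f q (u t) - f (y t) (w t)| <= c + L * `|q - y t|} ->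
  forall t, a <= t <= b -> `|x t - y t| < c * expR ((L + 1) * (t - a)).
Proof.
move=> ab [xX acx dx] [yX acy dy] L0 xya cr flip t tab.
apply: (gronwall ab (acB acx acy) L0 xya cr) => //.
apply: ae_imply (ae_and flip (ae_and dx dy)) => s [{}flip [{}dx {}dy]] sab sr.
exists (f (x s) (u s) - f (y s) (w s)); last exact: flip.
by apply: is_deriveB; [exact: dx|exact: dy].
Qed.

End Comparison.

(** * Uniqueness, and tracking of unperturbed trajectories *)

Section Tracking.
Variables (R : realType) (n : nat) (U : metricType R).
Variables (X : set 'rV[R]_n) (f : 'rV[R]_n -> U -> 'rV[R]_n).
Notation mu := (@lebesgue_measure R).
Hypothesis openX : open X.
Hypothesis f_continuous :
  {within X `*` [set: U], continuous (fun p : 'rV[R]_n * U => f p.1 p.2)}.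
Hypothesis f_lipschitz : locally_Lipschitz X f.
Implicit Types (p q : 'rV[R]_n) (v : U) (u w : R -> U) (x y : R -> 'rV[R]_n).

(** Inside a Lipschitz tube around one of the solutions, the comparison holds with
initial gap and forcing bounded by any c > 0. *)
Lemma solves_unique u a b x y (U0 : set U) : a <= b -> compact U0 ->
  {ae mu, forall t, a <= t <= b -> U0 (u t)} ->
  solves X f u a b x -> solves X f u a b y -> x a = y a -> x b = y b.
Proof.
move=> ab cU0 uU0 sx sy xya; have [yX acy _] := sy.
have CX : y @` `[a, b] `<=` X.
  by move=> _ [t + <-]; rewrite /= in_itv/=; exact: yX.
have [r [L [r0 L0 rL]]] := lipschitz_tube f_lipschitz (ac_curve_compact acy) CX cU0.
apply/eqP; rewrite -subr_eq0 -normr_le0; apply/ler_addgt0Pr => e e0; rewrite add0r.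
pose c := Num.min r e / expR ((L + 1) * (b - a)).
have cE : c * expR ((L + 1) * (b - a)) = Num.min r e.
  by rewrite /c divfK// gt_eqF// expR_gt0.
have c0 : 0 < c by rewrite divr_gt0 ?expR_gt0// lt_min r0.
have := @solutions_close _ _ _ _ _ u u a b x y c L r ab sx sy L0.
rewrite xya subrr normr0 cE ge_min lexx => /(_ c0 isT) H.
have {H} /H/(_ b) : {ae mu, forall t, a <= t <= b -> forall q, `|q - y t| < r ->
     `|f q (u t) - f (y t) (u t)| <= c + L * `|q - y t|}.
  apply: ae_imply uU0 => t U0t tab q qr.
  have [|_ /(_ _ (U0t tab))] := rL (y t) q _ qr.
    by exists t => //=; rewrite in_itv.
  by move=> /le_trans; apply; rewrite lerDr ltW.
rewrite ab lexx cE => /(_ isT)/ltW/le_trans; apply.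
by rewrite ge_min lexx orbT.
Qed.

(** The tolerance eta is fixed by the reference trajectory y and by rho, before the
input, the initial time and the perturbed solution are given. *)
Lemma tracking v T y rho : 0 <= T -> solves X f (fun=> v) 0 T y -> 0 < rho ->
  exists2 eta, 0 < eta & forall u a x, solves X f u a (a + T) x ->
    `|x a - y 0| < eta ->
    {ae mu, forall t, a <= t <= a + T -> mdist (u t) v < eta} ->
    forall t, a <= t <= a + T -> `|x t - y (t - a)| < rho.
Proof.
move=> T0 sy rho0; have [yX acy _] := sy.
have CX : y @` `[0, T] `<=` X.
  by move=> _ [t + <-]; rewrite /= in_itv/=; exact: yX.
have cC := ac_curve_compact acy.
have [r [L [r0 L0 rL]]] := lipschitz_tube f_lipschitz cC CX (@compact_set1 _ v).
have r2 : 0 < r / 2 by rewrite divr_gt0.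
have r2r : r / 2 < r by rewrite ltr_pdivrMr// ltr_pMr// ltrDl.
have NX : [set q | exists2 p, (y @` `[0, T]) p & `|q - p| <= r / 2] `<=` X.
  by move=> q [p Cp qp]; have [] := rL p q Cp (le_lt_trans qp r2r).
(* c is chosen so that its growth over [0, T] ends at min (r / 2, rho); the
   radius r / 2 leaves room for a compact tube inside the Lipschitz tube *)
pose c := Num.min (r / 2) rho / expR ((L + 1) * T).
have cE : c * expR ((L + 1) * T) = Num.min (r / 2) rho.
  by rewrite /c divfK// gt_eqF// expR_gt0.
have c0 : 0 < c by rewrite divr_gt0 ?expR_gt0// lt_min r2.
have [d d0 dN] := rhs_uniform_in_input openX f_continuous v
  (compact_neighbourhood cC) NX c0.
exists (Num.min c d); first by rewrite lt_min c0.
move=> u a x sx xy uv t /andP[at_ ta].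
have sy' := solves_shift a sy; rewrite add0r addrC in sy'.
have aaT : a <= a + T by rewrite lerDl.
have aTa : a + T - a = T by rewrite addrC addKr.
apply: (@lt_le_trans _ _ (c * expR ((L + 1) * (t - a)))); last first.
  apply: (@le_trans _ _ (c * expR ((L + 1) * T))); last by rewrite cE ge_min lexx orbT.
  by rewrite ler_pM2l// ler_expR ler_wpM2l ?addr_ge0// lerBlDl.
apply: (@solutions_close _ _ _ _ _ u _ a (a + T) x _ c L (r / 2) aaT sx sy' L0).
- by rewrite subrr; apply: lt_le_trans xy _; rewrite ge_min lexx.
- by rewrite aTa cE ge_min lexx.
- apply: ae_imply uv => s + /andP[as_ saT] q qr; rewrite as_ saT => /(_ isT).
  rewrite lt_min => /andP[_ ud].
  have Cs : (y @` `[0, T]) (y (s - a)).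
    by exists (s - a) => //=; rewrite in_itv/= subr_ge0 as_ lerBlDl.
  rewrite -(subrK (f q v) (f q (u s))) -addrA.
  apply: (le_trans (ler_normD _ _)); apply: lerD.
    by apply: dN => //; exists (y (s - a)) => //; exact: ltW.
  by have [_] := rL _ _ Cs (lt_trans qr r2r); exact.
- by rewrite at_.
Qed.

End Tracking.

(** * Total stability and recurrent trajectories *)

Section Stability.
Variables (R : realType) (n : nat) (U : metricType R).
Variables (X : set 'rV[R]_n) (f : 'rV[R]_n -> U -> 'rV[R]_n).
Variables (xbar : 'rV[R]_n) (ubar : U).
Notation mu := (@lebesgue_measure R).
Hypothesis openX : open X.
Hypothesis f_continuous :
  {within X `*` [set: U], continuous (fun p : 'rV[R]_n * U => f p.1 p.2)}.
Hypothesis f_lipschitz : locally_Lipschitz X f.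
Implicit Types (p q : 'rV[R]_n) (v : U) (u w : R -> U) (x y : R -> 'rV[R]_n).

Lemma solves_sub u a b a' b' x : a <= a' -> b' <= b ->
  solves X f u a b x -> solves X f u a' b' x.
Proof.
move=> aa bb [xX acx dx].
have sub t : a' <= t <= b' -> a <= t <= b.
  by move=> /andP[at_ tb]; rewrite (le_trans aa)// (le_trans tb).
split; [by move=> t /sub/xX|exact: ac_sub acx|].
by apply: ae_imply dx => t dx /sub/dx.
Qed.

(** Unperturbed trajectories in the basin of xbar.  Maximality is left out so that
the notion carries over to a system that agrees with f only near xbar. *)
Definition attracted y : Prop :=
  (forall b, 0 <= b -> solves X f (fun=> ubar) 0 b y) /\ y t @[t --> +oo] --> xbar.

Lemma attracted_time y e T0 : attracted y -> 0 < e ->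
  exists2 T, T0 <= T & `|y T - xbar| < e.
Proof.
move=> [_ /cvgrPdist_lt/(_ e) cy] e0; have [M [Mreal HM]] := cy e0.
exists (Num.max T0 (M + 1)); first by rewrite le_max lexx.
by rewrite distrC; apply: HM; rewrite lt_max ltrDl ltr01 orbT.
Qed.

Hypothesis stable : forall e, 0 < e -> exists2 d, 0 < d & forall p, `|p - xbar| < d ->
  exists y, [/\ attracted y, y 0 = p & forall t, 0 <= t -> `|y t - xbar| < e].

(** From each point of the closed ball of radius d the unperturbed trajectory stays
e/2-close to xbar and is d/2-close to it at a time T >= 1.  Tracking within d/2
therefore brings perturbed trajectories back to the ball, and the argument starts
again.  As each turn takes at least one unit of time, all times are covered. *)
Lemma total_stability e : 0 < e -> exists d eta, [/\ 0 < d, 0 < eta &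
  forall u a x, (forall b, a <= b -> solves X f u a b x) -> `|x a - xbar| <= d ->
    {ae mu, forall t, a <= t -> mdist (u t) ubar < eta} ->
    forall t, a <= t -> `|x t - xbar| < e].
Proof.
move=> e0; have e2 : 0 < e / 2 by rewrite divr_gt0.
have [d1 d10 stab] := stable e2.
pose d := Num.min (d1 / 2) (e / 2).
have d0 : 0 < d by rewrite lt_min e2 divr_gt0.
have d2 : 0 < d / 2 by rewrite divr_gt0.
have dd1 : d < d1 by rewrite gt_min ltr_pdivrMr// ltr_pMr// ltrDl ltr01.
have de : d <= e / 2 by rewrite ge_min lexx orbT.
have d2e : d / 2 <= e / 2 by rewrite (le_trans _ de)// ler_pdivrMr// ler_peMr ?ler1n// ltW.
have /near_covering_withinP cov := (compact_near_coveringP _).1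
  (@compact_closed_ball R n xbar d).
pose return_ eta p := forall u a x, (forall b, a <= b -> solves X f u a b x) -> x a = p ->
  {ae mu, forall t, a <= t -> mdist (u t) ubar < eta} ->
  exists T, [/\ 1 <= T, forall t, a <= t <= a + T -> `|x t - xbar| < e &
    `|x (a + T) - xbar| <= d].
have : \forall eta \near (0:R)^'+, [set q | `|q - xbar| <= d] `<=` return_ eta.
  apply: cov => p /= pd; have [y [ya y0 ye]] := stab _ (le_lt_trans pd dd1).
  have [T T1 yT] := attracted_time 1 ya d2.
  have T0 : 0 <= T by rewrite (le_trans ler01).
  have [eta eta0 track] :=
    tracking openX f_continuous f_lipschitz T0 (ya.1 _ T0) d2.
  exists (ball p eta, [set eta' | eta' < eta]) => /=.
    split; first by apply/nbhs_ballP; exists eta.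
    exact: nbhs_right_lt.
  move=> [q eta'] /= [pq eta'e] qd u a x sx xa uv.
  have aaT : a <= a + T by rewrite lerDl.
  have close : forall t, a <= t <= a + T -> `|x t - y (t - a)| < d / 2.
    apply: (track u) => //; first exact: sx.
      by rewrite xa y0 distrC; move: pq; rewrite -ball_normE.
    apply: ae_imply uv => t ut /andP[at_ _].
    by apply: (lt_trans _ eta'e); exact: ut.
  exists T; split=> // [t taT|].
    rewrite -(subrK (y (t - a)) (x t)) -addrA (le_lt_trans (ler_normD _ _))//.
    rewrite (splitr e) ltrD//; last by apply: ye; rewrite subr_ge0; case/andP: taT.
    exact: lt_le_trans (close _ taT) d2e.
  rewrite -(subrK (y T) (x (a + T))) -addrA (le_trans (ler_normD _ _))//.
  rewrite (splitr d) lerD ?(ltW yT)//.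
  by have := close (a + T); rewrite aaT lexx [a + T - a]addrAC subrr add0r => /(_ isT)/ltW.
move=> near_eta; near (0:R)^'+ => eta.
exists d, eta; split => // u a x sx xad uv.
have ret : [set q | `|q - xbar| <= d] `<=` return_ eta by near: eta.
have iter k : exists b, [/\ a + k%:R <= b, forall t, a <= t <= b -> `|x t - xbar| < e &
    `|x b - xbar| <= d].
  elim: k => [|k [b [akb xe xb]]].
    exists a; rewrite addr0 lexx; split=> // t; rewrite -eq_le => /eqP <-.
    by apply: (le_lt_trans xad); apply: (le_lt_trans de); rewrite ltr_pdivrMr// ltr_pMr// ltrDl.
  have ab : a <= b by apply: le_trans akb; rewrite lerDl.
  have [||T [T1 xT xbT]] := ret _ xb u b x _ erefl.
  - by move=> c bc; apply: (solves_sub ab (lexx c)); apply: sx; exact: le_trans bc.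
  - by apply: ae_imply uv => t ut bt; apply: ut; exact: le_trans bt.
  exists (b + T); split=> // [|t /andP[at_ tbT]].
    by rewrite -natr1 addrA lerD.
  by have [tb|/ltW bt] := leP t b; [apply: xe|apply: xT]; apply/andP.
move=> t at_; have [b [akb xe _]] := iter (Num.bound (t - a)).
apply: xe; rewrite at_/=; apply: le_trans akb.
by rewrite -lerBlDl ltW// archi_boundP// subr_ge0.
Unshelve. all: by end_near. Qed.

(** Near each point of K, tracking an attracted trajectory brings x into the ball
given by total stability, provided that the visit is late enough for the input
to be small; compactness of K makes one lower bound on the time suffice. *)
Lemma recurrent_cvg (K : set 'rV[R]_n) u x : compact K ->
  (forall p, K p -> exists2 y, attracted y & y 0 = p) ->
  u t @[t --> +oo] --> ubar ->
  (forall a b, 0 <= a -> a <= b -> solves X f u a b x) ->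
  recurrent K x -> x t @[t --> +oo] --> xbar.
Proof.
move=> cK Kattr ucvg sx recx; apply/cvgrPdist_lt => e e0.
have u_near eta : 0 < eta -> \forall i \near +oo, forall t, i <= t -> mdist (u t) ubar < eta.
  move=> eta0; have [M [Mreal HM]] := ucvg _ (nbhsx_ballx ubar _ eta0).
  exists M; split=> // i Mi t it; have := HM t (lt_le_trans Mi it).
  by rewrite ballEmdist /= metric_sym.
have [d [eta [d0 eta0 stay]]] := total_stability e0.
have d2 : 0 < d / 2 by rewrite divr_gt0.
have /near_covering_withinP cov := (compact_near_coveringP _).1 cK.
have reach : \forall i \near pinfty_nbhs R, K `<=` (fun i p => forall t, 0 <= t -> i <= t -> x t = p ->
    exists2 t', t <= t' & `|x t' - xbar| <= d) i.
  apply: cov => p Kp; have [y ya y0] := Kattr _ Kp.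
  have [T T0 yT] := attracted_time 0 ya d2.
  have [eta' eta'0 track] :=
    tracking openX f_continuous f_lipschitz T0 (ya.1 _ T0) d2.
  exists (ball p eta', [set i | forall t, i <= t -> mdist (u t) ubar < eta']) => /=.
    by split; [apply/nbhs_ballP; exists eta'|exact: u_near].
  move=> [q i] /= [pq ui] Kq t t0 it xt.
  have ttT : t <= t + T by rewrite lerDl.
  exists (t + T) => //.
  have close : forall s, t <= s <= t + T -> `|x s - y (s - t)| < d / 2.
    apply: (track u) => //; first exact: sx.
      by rewrite xt y0 distrC; move: pq; rewrite -ball_normE.
    apply: aeW => s /andP[ts _]; apply: ui; exact: le_trans ts.
  rewrite -(subrK (y T) (x (t + T))) -addrA (le_trans (ler_normD _ _))//.
  rewrite (splitr d) lerD ?(ltW yT)//.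
  by have := close (t + T); rewrite ttT lexx [t + T - t]addrAC subrr add0r => /(_ isT)/ltW.
near +oo_R => i.
have ui : forall t, i <= t -> mdist (u t) ubar < eta by near: i; exact: u_near.
have ri : K `<=` (fun p => forall t, 0 <= t -> i <= t -> x t = p ->
    exists2 t', t <= t' & `|x t' - xbar| <= d) by near: i.
have i0 : 0 < i by near: i; apply: nbhs_pinfty_gt; exact: num_real.
have [t it Kt] := recx i i0.
have [t' tt' xt'] := ri _ Kt t (ltW (lt_trans i0 it)) (ltW it) erefl.
have t'0 : 0 <= t' by apply: le_trans tt'; rewrite ltW// (lt_trans i0).
exists t'; split=> [|s /ltW t's]; first exact: num_real.
rewrite distrC; apply: (stay u t' x) => //.
- by move=> b; exact: sx.
- by apply: aeW => r t'r; apply: ui; apply: le_trans t'r; rewrite ltW// (lt_le_trans it).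
Unshelve. all: by end_near. Qed.

End Stability.

(** * Lipschitz primitives of bounded measurable functions *)

Section Primitive.
Variable R : realType.
Notation mu := (@lebesgue_measure R).
Implicit Types (g h : R -> R) (t : R).

(** The Caratheodory sigma-algebra is the completion of the Borel one: its members
are unions of a Borel set and a negligible set. *)
Lemma Lebesgue_measurable_kernel (A : set R) : Lebesgue_measurable A ->
  exists B : set (measurableTypeR R), [/\ measurable B, B `<=` A & mu.-negligible (A `\` B)].
Proof.
rewrite /Lebesgue_measurable -completed_caratheodory_measurable.
rewrite g_sigma_completed_algebra_genE => -[B mB [N negN] <-].
exists B; split; [exact: mB|by move=> t; left|].
by apply: negligibleS negN => t [[|]].
Qed.

(** Numbers that encode no rational are sent to 0; the repetitions are harmless, as
only suprema and unions are taken over the sequence. *)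
Definition rat_seq (k : nat) : rat := odflt 0 (unpickle k).

Lemma rat_seqP q : exists k, rat_seq k = q.
Proof. by exists (pickle q); rewrite /rat_seq pickleK. Qed.

(** Where |g| <= M, g(t) is the supremum of the rationals q with q < g(t).  Replacing
each superlevel set by a Borel subset of full measure and clipping q to [-M, M]
turns this supremum into a Borel function, and the error is confined to a
countable union of null sets. *)
Lemma borel_representative (D : set R) g M : 0 <= M ->
  (forall q : rat, Lebesgue_measurable (D `&` g @^-1` [set z | ratr q < z])) ->
  exists h, [/\ measurable_fun setT h, forall t, `|h t| <= M &
    {ae mu, forall t, D t -> `|g t| <= M -> h t = g t}].
Proof.
move=> M0 mg; have NMM : - M <= M by rewrite (le_trans _ M0)// oppr_le0.
pose B k := sval (cid (Lebesgue_measurable_kernel (mg (rat_seq k)))).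
have BP k : [/\ measurable (B k), B k `<=` D `&` g @^-1` [set z | ratr (rat_seq k) < z] &
    mu.-negligible ((D `&` g @^-1` [set z | ratr (rat_seq k) < z]) `\` B k)].
  by rewrite /B; case: cid.
pose clip z := Num.min M (Num.max (- M) z) : R.
have clipM z : - M <= clip z <= M.
  by rewrite /clip le_min NMM le_max lexx/= ge_min lexx.
pose phi k t := if t \in B k then clip (ratr (rat_seq k)) else - M.
have phiM k t : - M <= phi k t <= M by rewrite /phi; case: ifP => _ //; rewrite lexx.
have ub t : has_ubound (range (phi ^~ t)).
  by exists M => _ [k _ <-]; case/andP: (phiM k t).
pose h t := sups (phi ^~ t) 0.
have hE t : h t = sup (range (phi ^~ t)).
  rewrite /h /sups /sdrop; congr sup; apply/seteqP; split=> z /=.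
    by move=> [k _ <-]; exists k.
  by move=> [k _ <-]; exists k.
have phih k t : phi k t <= h t by rewrite hE; apply: ub_le_sup => //; exists k.
have hle t z : (forall k, phi k t <= z) -> h t <= z.
  by move=> H; rewrite hE; apply: ge_sup; [exists (phi 0 t), 0|move=> _ [k _ <-]].
exists h; split.
- apply: measurable_fun_sups => // k; apply: measurable_fun_ifT => //.
  have [mB _ _] := BP k.
  by apply: (measurable_fun_bool true); rewrite setTI (_ : _ @^-1` _ = B k)//;
    apply/seteqP; split=> t /= => [/set_mem|/mem_set].
- move=> t; rewrite ler_norml hle ?andbT.
    by apply: le_trans (phih 0 t); case/andP: (phiM 0 t).
  by move=> k; case/andP: (phiM k t).
- have : mu.-negligible (\bigcup_k ((D `&` g @^-1` [set z | ratr (rat_seq k) < z]) `\` B k)).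
    by apply: negligible_bigcup => k; have [] := BP k.
  apply: negligibleS => t /= /not_implyP[Dt /not_implyP[gM hg]].
  apply: contrapT => tN; apply: hg; move: gM; rewrite ler_norml => /andP[Mg gM].
  have phiE k : phi k t = if ratr (rat_seq k) < g t then clip (ratr (rat_seq k)) else - M.
    rewrite /phi; have [_ BD _] := BP k; case: ifPn => [/set_mem/BD[_ /= ->]//|tB].
    case: ifPn => // qg; exfalso; apply: tN; exists k => //; split=> //.
    by move=> Bt; move: tB; rewrite mem_set.
  apply/eqP; rewrite eq_le; apply/andP; split.
    apply: hle => k; rewrite phiE; case: ifPn => // qg.
    by rewrite /clip ge_min ge_max Mg (ltW qg) orbT.
  apply/ler_addgt0Pr => e e0.
  have ge : g t - e < g t by rewrite ltrBlDr ltrDl.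
  have [q] := rat_in_itvoo ge; rewrite in_itv/= => /andP[gq qg].
  have [k kq] := rat_seqP q; rewrite -lerBlDr; apply: le_trans (phih k t).
  rewrite phiE kq qg /clip le_min le_max (ltW gq) orbT andbT.
  by apply: le_trans gM; exact: ltW.
Qed.

Lemma lipschitz_primitive h M : 0 <= M -> measurable_fun setT h ->
  (forall t, `|h t| <= M) -> exists G : R -> R,
  [/\ G 0 = 0, forall s t, `|G s - G t| <= M * `|s - t| &
    {ae mu, forall t, 0 <= t -> is_derive t (1 : R) G (h t)}].
Proof.
move=> M0 mh hM.
have ih (A : set R) : measurable A -> (mu A < +oo)%E -> mu.-integrable A (EFin \o h).
  move=> mA Aoo; apply: measurable_bounded_integrable => //.
    exact: measurable_funS mh.
  exists M; split; first exact: num_real.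
  by move=> z Mz t _ /=; apply: (le_trans (hM t)); exact: ltW.
have iitv a b : mu.-integrable `[a, b] (EFin \o h).
  apply: ih => //; rewrite lebesgue_measure_itv/=; case: ifP => _ //.
  by rewrite -EFinB ltry.
pose G t := \int[mu]_(s in `[0, t]) h s.
have Gneg t : t <= 0 -> G t = 0.
  rewrite le_eqVlt => /orP[/eqP ->|t0]; first by rewrite /G set_itv1 Rintegral_set1.
  by rewrite /G set_itv_ge ?Rintegral_set0// bnd_simp -ltNge.
have GM s t : 0 <= s -> s <= t -> `|G t - G s| <= M * (t - s).
  move=> s0 st; rewrite /G (Rintegral_itvB (iitv 0 t)) ?bnd_simp//.
  have ist : mu.-integrable `]s, t] (EFin \o h).
    by apply: integrableS (iitv 0 t) => //; apply: subset_itv; rewrite bnd_simp.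
  apply: (le_trans (le_normr_Rintegral _ ist)) => //.
  have mst : (mu `]s, t] < +oo)%E.
    by rewrite lebesgue_measure_itv/=; case: ifP => _ //; rewrite -EFinB ltry.
  apply: (@le_trans _ _ (\int[mu]_(z in `]s, t]) M)).
    apply: le_Rintegral => //.
    - exact: integrable_norm ist.
    - apply: measurable_bounded_integrable => //; exists M; split; first exact: num_real.
      by move=> z Mz w _ /=; rewrite ger0_norm// ltW.
  have muE : fine (mu `]s, t]) = t - s.
    rewrite lebesgue_measure_itv/= lte_fin; case: ltP => //= ts.
    by apply/esym/eqP; rewrite subr_eq0 eq_le ts.
  by rewrite Rintegral_cst// [X in _ * X]muE.
exists G; split; first exact: Gneg.
  have GM' s t : s <= t -> `|G t - G s| <= M * (t - s).
    move=> st; have [s0|/ltW s0] := leP 0 s; first exact: GM.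
    have [t0|/ltW t0] := leP 0 t; last by rewrite !Gneg// subrr normr0 mulr_ge0// subr_ge0.
    rewrite (Gneg s)// -(Gneg 0)//; apply: (le_trans (GM _ _ (lexx 0) t0)).
    by rewrite ler_wpM2l// lerD2l lerN2.
  move=> s t; have [st|/ltW ts] := leP s t.
    by rewrite distrC (distrC s) (ger0_norm (_ : 0 <= t - s)) ?GM' ?subr_ge0.
  by rewrite (ger0_norm (_ : 0 <= s - t)) ?GM' ?subr_ge0.
have locf : locally_integrable [set: R] h.
  split=> //; first exact: openT.
  move=> K _ cK; have mK : measurable K by exact: compact_measurable.
  have := ih _ mK (compact_finite_measure cK).
  by move=> /integrableP[].
have Gh := @FTC1 R h (BLeft 0) (iitv 0) locf.
have ae0 : {ae mu, forall t, t <> 0}.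
  exists [set 0]; split=> //; first exact: lebesgue_measure_set1.
  by move=> t /= /contrapT.
apply: ae_imply (ae_and ae0 Gh) => t [/eqP tn0 Gt] t0.
have [|dG <-] := Gt _; first by rewrite (@lte_fin R) lt_neqAle eq_sym tn0.
by rewrite derive1E; exact: derivableP.
Qed.

End Primitive.

(** * Geometric convergence and measurability along an input *)

Lemma geometric_small (R : realType) (D e : R) : 0 < e -> exists k, D * 2^-1 ^+ k < e.
Proof.
move=> e0; have half1 : `|2^-1 : R| < 1.
  by rewrite ger0_norm ?invr_ge0// invf_lt1// ltr1n.
have [N _ HN] := (cvgrPdist_lt _ _).1 (@cvg_geometric R D _ half1) e e0.
exists N; have := HN N (leqnn N); rewrite sub0r normrN.
exact: le_lt_trans (ler_norm _).
Qed.

Lemma geometric_le_near (R : realType) (V : normedModType R) (z : nat -> V) B :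
  (forall k, `|z k.+1 - z k| <= B * 2^-1 ^+ k) ->
  forall k m, (k <= m)%N -> `|z m - z k| <= 2 * B * 2^-1 ^+ k.
Proof.
move=> zB k m /subnKC <-.
suff : `|z (k + (m - k))%N - z k| <= 2 * B * (2^-1 ^+ k - 2^-1 ^+ (k + (m - k))).
  move=> /le_trans; apply; have B0 : 0 <= B.
    by have := le_trans (normr_ge0 _) (zB 0); rewrite expr0 mulr1.
  by rewrite ler_wpM2l ?mulr_ge0// lerBlDr lerDl exprn_ge0.
elim: (m - k)%N => [|d IH]; first by rewrite addn0 !subrr normr0 mulr0.
rewrite addnS -(subrK (z (k + d)%N) (z _.+1)) -addrA.
apply: (le_trans (ler_normD _ _)); apply: (le_trans (lerD (zB _) IH)).
rewrite exprS; set h := 2^-1 ^+ (k + d); set h' := 2^-1 ^+ k.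
by clear; lra.
Qed.

Lemma geometric_cvg (R : realType) n (z : nat -> 'rV[R]_n) B :
  (forall k, `|z k.+1 - z k| <= B * 2^-1 ^+ k) -> cvg (z @ \oo).
Proof.
move=> zB; apply: cauchy_cvg; apply: cauchy_exP => e e0.
have [k ke] := geometric_small (2 * B) e0.
exists (z k); exists k => // m /= km.
by rewrite -ball_normE /ball_/= distrC (le_lt_trans (geometric_le_near zB km)).
Qed.

(** The tail of the geometric series adds up to twice its first term. *)
Lemma geometric_lim_le (R : realType) (V : normedModType R) (z : nat -> V) B l :
  (forall k, `|z k.+1 - z k| <= B * 2^-1 ^+ k) -> z @ \oo --> l ->
  forall k, `|l - z k| <= 2 * B * 2^-1 ^+ k.
Proof.
move=> zB /cvgrPdist_le zl k; apply/ler_addgt0Pr => e e0.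
have [N _ HN] := zl e e0.
have lm := HN (maxn N k) (leq_maxl _ _).
rewrite -(subrK (z (maxn N k)) l) -addrA (le_trans (ler_normD _ _))// [leRHS]addrC lerD//.
exact: (geometric_le_near zB (leq_maxr _ _)).
Qed.

Section Superposition.
Variables (R : realType) (U : metricType R).
Notation mu := (@lebesgue_measure R).

(** By continuity, H(t, u(t)) lies in W exactly when t belongs to some rational
interval (p, q) and u(t) to the union V p q of the open sets W' such that H maps
(p, q) x W' into W.  Only the rational intervals are counted; the sets W' form
a single open set for each of them. *)
Lemma superposition_measurable (H : R * U -> R) (u : R -> U) : continuous H ->
  (forall W, open W -> Lebesgue_measurable (half_line (R:=R) `&` u @^-1` W)) ->
  forall W, open W -> Lebesgue_measurable (half_line (R:=R) `&` (fun t => H (t, u t)) @^-1` W).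
Proof.
move=> Hcont mu_ W oW.
pose V (p q : rat) : set U := \bigcup_(W' in [set W' | open W' /\
  forall s v, ratr p < s < ratr q -> W' v -> W (H (s, v))]) W'.
have -> : half_line (R:=R) `&` (fun t => H (t, u t)) @^-1` W =
    \bigcup_p \bigcup_q ((half_line (R:=R) `&` u @^-1` V p q) `&` `]ratr p, ratr q[).
  apply/seteqP; split=> t /=; last first.
    move=> [p _ [q _ [[t0 [W' [oW' HW'] W't]]]]]; rewrite /= in_itv/= => tpq.
    by split=> //; exact: HW' tpq W't.
  move=> [t0 WH]; have [[A B] /= [/nbhs_ballP[d /= d0 dA] Bv] AB] :
      nbhs (t, u t) (H @^-1` W) by apply: Hcont; exact: open_nbhs_nbhs.
  have td : t - d < t by rewrite ltrBlDr ltrDl.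
  have dt : t < t + d by rewrite ltrDl.
  have [p] := rat_in_itvoo td; have [q] := rat_in_itvoo dt.
  rewrite !in_itv/= => /andP[tq qt] /andP[pt tp].
  exists p => //; exists q => //; split; last by rewrite /= in_itv/= tp.
  split=> //; exists B^°; last by [].
  split; first exact: open_interior.
  move=> s v /andP[ps sq] Bsv; apply: (AB (s, v)); split=> /=; last exact: interior_subset.
  by apply: dA; rewrite /ball/= ltr_distlC (lt_trans pt)// (lt_trans sq).
apply: bigcupT_measurable_rat => p; apply: bigcupT_measurable_rat => q.
apply: measurableI; last by apply: sub_caratheodory; exact: measurable_itv.
by apply: mu_; apply: bigcup_open => W' [].
Qed.

End Superposition.

(** * Global existence by Picard iteration *)

Section Picard.
Variables (R : realType) (n : nat) (U : metricType R).
Notation mu := (@lebesgue_measure R).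

Lemma ae_forall_ord m (P : 'I_m -> R -> Prop) :
  (forall i, {ae mu, forall t : R, P i t}) -> {ae mu, forall t : R, forall i, P i t}.
Proof.
move=> aeP. apply: filter_forall => // ; exact: (ae_filter_ringOfSetsType mu).
Qed.

Lemma row_primitive (phi : R -> 'rV[R]_n) M : 0 <= M ->
  (forall i W, open W ->
     Lebesgue_measurable (half_line (R:=R) `&` (fun t => phi t ord0 i) @^-1` W)) ->
  {ae mu, forall t : R, 0 <= t -> `|phi t| <= M} ->
  exists G : R -> 'rV[R]_n, [/\ G 0 = 0, forall s t : R, `|G s - G t| <= M * `|s - t| &
    {ae mu, forall t : R, 0 <= t -> is_derive t (1 : R) G (phi t)}].
Proof.
move=> M0 mphi phiM.
have prim i : exists g : R -> R, [/\ g 0 = 0, forall s t : R, `|g s - g t| <= M * `|s - t| &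
    {ae mu, forall t : R, 0 <= t -> is_derive t (1 : R) g (phi t ord0 i)}].
  have [|h [mh hM aeh]] := @borel_representative R (half_line (R:=R)) (fun t => phi t ord0 i) M M0.
    by move=> q; apply: mphi; exact: open_gt.
  have [g [g0 gM dg]] := lipschitz_primitive M0 mh hM.
  exists g; split=> //; apply: ae_imply (ae_and dg (ae_and aeh phiM)) => t [{}dg [{}aeh {}phiM]] t0.
  rewrite -aeh//; first exact: dg.
  exact: le_trans (coord_le_norm _ _) (phiM t0).
pose g i := sval (cid (prim i)).
have gP i : [/\ g i 0 = 0, forall s t : R, `|g i s - g i t| <= M * `|s - t| &
    {ae mu, forall t : R, 0 <= t -> is_derive t (1 : R) (g i) (phi t ord0 i)}].
  by rewrite /g; case: cid.
exists (fun t => \row_i g i t); split.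
- by apply/rowP => i; rewrite !mxE; have [] := gP i.
- move=> s t; apply: norm_le_coord => [|i]; first by rewrite mulr_ge0.
  by rewrite !mxE; have [] := gP i.
have dgP : {ae mu, forall t : R, forall i, 0 <= t -> is_derive t (1 : R) (g i) (phi t ord0 i)}.
  by apply: ae_forall_ord => i; have [] := gP i.
apply: ae_imply dgP => t dg t0; apply/is_derive_slope => e e0.
have near_slopes : \forall s \near t, forall i : 'I_n,
    `|g i s - g i t - (s - t) *: phi t ord0 i| <= e * `|s - t|.
  pose P (i : 'I_n) s := `|g i s - g i t - (s - t) *: phi t ord0 i| <= e * `|s - t|.
  have Pi i : \forall s \near t, P i s.
    exact: ((is_derive_slope _ _ _).1 (dg i t0) _ e0).
  exact: (@filter_forall R 'I_n P (nbhs t) _ Pi).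
apply: filterS near_slopes => s ds; apply: norm_le_coord => [|i]; first by rewrite mulr_ge0// ltW.
by have := ds i; rewrite !mxE.
Qed.

Variables (F : 'rV[R]_n -> U -> 'rV[R]_n) (u : R -> U) (M : R) (xi : 'rV[R]_n).
Hypothesis F_continuous : continuous (fun p : 'rV[R]_n * U => F p.1 p.2).
Hypothesis u_measurable :
  forall W, open W -> Lebesgue_measurable (half_line (R:=R) `&` u @^-1` W).
Hypothesis M0 : 0 <= M.
Hypothesis F_bounded : {ae mu, forall t : R, 0 <= t -> forall p, `|F p (u t)| <= M}.
Hypothesis F_lipschitz : forall T, 0 <= T -> exists2 L, 0 <= L &
  {ae mu, forall t : R, 0 <= t <= T -> forall p q, `|F p (u t) - F q (u t)| <= L * `|p - q|}.

Let lip (x : R -> 'rV[R]_n) := forall s t : R, `|x s - x t| <= M * `|s - t|.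

Let lip_continuous x : lip x -> continuous x.
Proof.
move=> xM t; apply/cvgrPdist_lt => e e0; apply/nbhs_ballP.
have M1 : 0 < M + 1 by rewrite ltr_wpDl.
exists (e / (M + 1)); first exact: divr_gt0.
move=> s; rewrite /ball/= ltr_pdivlMr// => st; apply: le_lt_trans (xM _ _) _.
by apply: le_lt_trans st; rewrite mulrC ler_wpM2l// lerDl.
Qed.

Let lip_ac x b : lip x -> ac 0 b x.
Proof.
move=> xM; apply: abs_continuous_ac; apply: (@lipschitz_abs_continuous _ _ _ _ M).
by move=> s t _ st _; rewrite (le_trans (xM _ _))// ger0_norm// subr_ge0.
Qed.

(** The primitive of t |-> F(x(t), u(t)) starting at xi.  The bound on F makes it
M-Lipschitz, so that it can be fed back into the iteration. *)
Let picard_step x : exists y, lip x ->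
  [/\ y 0 = xi, lip y & {ae mu, forall t : R, 0 <= t -> is_derive t (1 : R) y (F (x t) (u t))}].
Proof.
have [xM|nxM] := pselect (lip x); last by exists x.
have [|G [G0 GM dG]] := @row_primitive (fun t => F (x t) (u t)) M M0 _
    (ae_imply (fun t Ft t0 => Ft t0 (x t)) F_bounded).
  move=> i; apply: (@superposition_measurable R U (fun z => F (x z.1) z.2 ord0 i)) => //.
  move=> z; apply: (@continuous_comp _ _ _ (fun z => F (x z.1) z.2) (fun v : 'rV_n => v ord0 i)).
    apply: (@continuous_comp _ _ _ (fun z => (x z.1, z.2)) (fun p => F p.1 p.2)).
      case: z => s v A [[B C] /= [xB vC] BCA].
      exists (x @^-1` B, C); first by split; [exact: (lip_continuous xM xB)|exact: vC].
      by move=> [s' v'] /= [? ?]; apply: (BCA (x s', v')).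
    exact: F_continuous.
  exact: coord_continuous.
exists (fun t => xi + G t) => _; split.
- by rewrite G0 addr0.
- by move=> s t; rewrite opprD addrACA subrr add0r.
- apply: ae_imply dG => t dG t0.
  rewrite -[X in is_derive _ _ _ X]add0r.
  by apply: is_deriveD; exact: dG.
Qed.

(** In the norm sup |x(t)| exp(-2 L t) over [0, T] the Picard operator contracts by
the factor 1/2, by the mean value inequality with phi = (c/2) exp(2 L t).  The
constant L may depend on T: the iterates do not, so their pointwise limit exists
on the whole half-line and the estimates are only used on compact intervals. *)
Lemma caratheodory_existence : exists y : R -> 'rV[R]_n,
  [/\ y 0 = xi, lip y & {ae mu, forall t : R, 0 <= t -> is_derive t (1 : R) y (F (y t) (u t))}].
Proof.
have [P HP] := choice picard_step.
have contract L T c x x' : 0 <= L ->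
    {ae mu, forall t : R, 0 <= t <= T -> forall p q, `|F p (u t) - F q (u t)| <= L * `|p - q|} ->
    lip x -> lip x' -> 0 <= c ->
    (forall s : R, 0 <= s <= T -> `|x s - x' s| <= c * expR (2 * L * (s - 0))) ->
    forall t : R, 0 <= t <= T -> `|P x t - P x' t| <= c / 2 * expR (2 * L * (t - 0)).
  move=> L0 FL xM x'M c0 xx' t /andP[t0 tT].
  have [Px0 PxM dPx] := HP x xM; have [Px'0 Px'M dPx'] := HP x' x'M.
  pose phi (s : R) := c / 2 * expR (2 * L * (s - 0)).
  have phi0 s : 0 <= phi s by rewrite mulr_ge0 ?expR_ge0 ?divr_ge0.
  apply: (@le_trans _ _ (phi t - phi 0)); last by rewrite gerBl.
  have -> : P x t - P x' t = (P x - P x') t - (P x - P x') 0.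
    by rewrite -[(P x - P x') 0]/(P x 0 - P x' 0) Px0 Px'0 subrr subr0.
  apply: mean_value_ineq => //.
  - by apply: acB; exact: lip_ac.
  - move=> s s' _ ss' _; rewrite ler_wpM2l ?divr_ge0// ler_expR.
    by rewrite ler_wpM2l ?mulr_ge0// lerD2r.
  apply: ae_imply (ae_and FL (ae_and dPx dPx')) => s [{}FL [{}dPx {}dPx']] /andP[s0 st].
  have sT : 0 <= s <= T by rewrite s0 (le_trans st).
  exists (F (x s) (u s) - F (x' s) (u s)), (2 * L * phi s); split.
  - by apply: is_deriveB; [exact: dPx|exact: dPx'].
  - exact: is_derive_scaled_exp.
  - apply: (le_trans (FL sT _ _)); apply: (le_trans (ler_wpM2l L0 (xx' s sT))).
    rewrite /phi; set E := expR _.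
    by have -> : 2 * L * (c / 2 * E) = L * (c * E) by field.
pose z k := iter k P (fun=> xi).
have zlip k : lip (z k).
  elim: k => [|k IH]; first by move=> s t; rewrite subrr normr0 mulr_ge0.
  by have [] := HP _ IH.
have zS k : z k.+1 = P (z k) by [].
have z0 k : z k 0 = xi by case: k => [//|k]; have [] := HP _ (zlip k).
have close T : 0 <= T -> exists L C : R, [/\ 0 <= L, 0 <= C,
    {ae mu, forall t : R, 0 <= t <= T -> forall p q, `|F p (u t) - F q (u t)| <= L * `|p - q|} &
    forall t k, 0 <= t <= T ->
      `|z k.+1 t - z k t| <= C * expR (2 * L * (t - 0)) * 2^-1 ^+ k].
  move=> T0; have [L L0 FL] := F_lipschitz T0; exists L, (M * T); split=> //.
    exact: mulr_ge0.
  move=> t k; elim: k t => [|k IH] t t0T.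
    rewrite expr0 mulr1; have [t0 tT] := andP t0T.
    apply: (@le_trans _ _ (M * T)).
      have := zlip 1%N t 0; rewrite z0 subr0 ger0_norm// => /le_trans; apply.
      by rewrite ler_wpM2l.
    by rewrite ler_peMr ?mulr_ge0// -expR0 ler_expR mulr_ge0 ?mulr_ge0 ?subr0.
  have c0 : 0 <= M * T * 2^-1 ^+ k by rewrite mulr_ge0 ?exprn_ge0 ?mulr_ge0.
  have IH' s : 0 <= s <= T ->
      `|z k.+1 s - z k s| <= M * T * 2^-1 ^+ k * expR (2 * L * (s - 0)).
    by rewrite mulrAC; exact: IH.
  have := contract L T _ _ _ L0 FL (zlip k.+1) (zlip k) c0 IH' t t0T.
  rewrite -!zS => /le_trans; apply; rewrite exprSr; set E := expR _.
  by have -> : M * T * 2^-1 ^+ k / 2 * E = M * T * E * (2^-1 ^+ k * 2^-1) by ring.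
pose x t := lim (z k t @[k --> \oo]).
have zx t : 0 <= t -> z k t @[k --> \oo] --> x t.
  move=> t0; have [L [C [_ _ _ zC]]] := close t t0.
  apply: (@geometric_cvg _ _ (fun k => z k t) (C * expR (2 * L * (t - 0)))).
  move=> k.
  by apply: zC; rewrite t0 lexx.
(* extended to the left of 0 so as to be Lipschitz on the whole line *)
pose xp t := x (Num.max 0 t).
have xpE t : 0 <= t -> xp t = x t by move=> t0; rewrite /xp max_r.
have zx_close L C t : (forall k, `|z k.+1 t - z k t| <= C * expR (2 * L * (t - 0)) * 2^-1 ^+ k) ->
    0 <= t -> forall k, `|x t - z k t| <= 2 * (C * expR (2 * L * (t - 0))) * 2^-1 ^+ k.
  by move=> zC t0; apply: (geometric_lim_le zC); exact: zx.
have xlip s t : 0 <= s -> 0 <= t -> `|x s - x t| <= M * `|s - t|.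
  move=> s0 t0; apply/ler_addgt0Pr => e e0; have e2 : 0 < e / 2 by rewrite divr_gt0.
  have [N _ HN] := (cvgrPdist_le _ _).1 (zx s s0) _ e2.
  have [N' _ HN'] := (cvgrPdist_le _ _).1 (zx t t0) _ e2.
  have hs := HN (maxn N N') (leq_maxl _ _); have ht := HN' (maxn N N') (leq_maxr _ _).
  have hst := zlip (maxn N N') s t.
  set k := maxn N N' in hs ht hst.
  have -> : x s - x t = (x s - z k s) - (x t - z k t) + (z k s - z k t).
    by rewrite subrACA subrK.
  apply: (le_trans (ler_normD _ _)); rewrite [leRHS]addrC lerD//.
  by apply: (le_trans (ler_normB _ _)); rewrite (splitr e) lerD.
have xplip : lip xp.
  move=> s t; apply: (le_trans (xlip _ _ _ _)); rewrite ?le_max ?lexx//.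
  by rewrite ler_wpM2l// dist_max.
have [y0 ylip dy] := HP xp xplip.
have yx t : 0 <= t -> P xp t = x t.
  move=> t0; have [L [C [L0 C0 FL zC]]] := close t t0.
  apply/eqP; rewrite -subr_eq0 -normr_le0; apply/ler_addgt0Pr => e e0; rewrite add0r.
  have [k ke] := geometric_small (2 * (C * expR (2 * L * (t - 0)))) e0.
  apply: ltW; apply: le_lt_trans ke.
  have c0 : 0 <= 2 * C * 2^-1 ^+ k by rewrite !mulr_ge0 ?exprn_ge0.
  have tt : 0 <= t <= t by rewrite t0 lexx.
  have h1 : `|P xp t - z k.+1 t| <= 2 * C * 2^-1 ^+ k / 2 * expR (2 * L * (t - 0)).
    apply: (contract L t _ xp (z k)) => // s /andP[s0 st]; rewrite xpE//.
    have := zx_close L C s (fun k => zC s k (introT andP (conj s0 st))) s0 k.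
    by move=> /le_trans; apply; rewrite mulrA mulrAC.
  have h2 := zx_close L C t (fun k => zC t k tt) t0 k.+1.
  rewrite -(subrK (z k.+1 t) (P xp t)) -addrA (le_trans (ler_normD _ _))//.
  rewrite (distrC (z _ t)); apply: (le_trans (lerD h1 h2)).
  rewrite exprSr; set E := expR _; set h := 2^-1 ^+ k.
  by have -> : 2 * (C * E) * h = 2 * C * h / 2 * E + 2 * (C * E) * (h * 2^-1) by field.
exists (P xp); split=> //; apply: ae_imply dy => t dy t0.
by rewrite yx// -xpE//; exact: dy.
Qed.

End Picard.

(** * The system clamped to a box *)

Section Clamp.
Variables (R : realType) (n : nat) (c : 'rV[R]_n) (s : R).
Hypothesis s0 : 0 <= s.
Implicit Types p q : 'rV[R]_n.

(** The nearest-point projection onto the box around c, coordinate by coordinate. *)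
Definition clamp p : 'rV[R]_n :=
  \row_i Num.max (c ord0 i - s) (Num.min (c ord0 i + s) (p ord0 i)).

Lemma clamp_coord_lipschitz p q i :
  `|(clamp p - clamp q) ord0 i| <= `|(p - q) ord0 i|.
Proof. by rewrite !mxE (le_trans (dist_max _ _ _))// dist_min. Qed.

Lemma clamp_lipschitz p q : `|clamp p - clamp q| <= `|p - q|.
Proof.
apply: norm_le_coord => // i.
exact: le_trans (clamp_coord_lipschitz _ _ _) (coord_le_norm _ _).
Qed.

Lemma enorm_clamp_lipschitz p q : enorm (clamp p - clamp q) <= enorm (p - q).
Proof.
rewrite ler_wsqrtr// ler_sum// => i _.
rewrite -(real_normK (num_real ((clamp p - clamp q) ord0 i))).
rewrite -(real_normK (num_real ((p - q) ord0 i))).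
by rewrite ler_sqr ?nnegrE// clamp_coord_lipschitz.
Qed.

Lemma clamp_in p : `|clamp p - c| <= s.
Proof.
apply: norm_le_coord => // i; rewrite !mxE ler_norml.
rewrite lerBrDl le_max lexx/= lerBlDl ge_max ge_min lexx /= andbT.
by rewrite lerD2l (le_trans _ s0)// oppr_le0.
Qed.

Lemma clamp_id p : `|p - c| <= s -> clamp p = p.
Proof.
move=> ps; apply/rowP => i; rewrite mxE.
have := le_trans (coord_le_norm (p - c) i) ps; rewrite !mxE ler_norml => /andP[h1 h2].
by rewrite min_r ?max_r; [|rewrite lerBlDl -lerBlDr -lerBrDl; lra|lra].
Qed.

End Clamp.

Section ClampedSystem.
Variables (R : realType) (n : nat) (U : metricType R).
Variables (X : set 'rV[R]_n) (f : 'rV[R]_n -> U -> 'rV[R]_n).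
Variables (xbar : 'rV[R]_n) (ubar : U) (s : R).
Notation mu := (@lebesgue_measure R).
Hypothesis openX : open X.
Hypothesis f_continuous :
  {within X `*` [set: U], continuous (fun p : 'rV[R]_n * U => f p.1 p.2)}.
Hypothesis f_lipschitz : locally_Lipschitz X f.
Hypothesis s0 : 0 <= s.
Hypothesis box_sub : [set q | `|q - xbar| <= s] `<=` X.

Let clampX p : X (clamp xbar s p).
Proof. exact/box_sub/clamp_in. Qed.

Definition clamped p v := f (clamp xbar s p) v.

Lemma clamped_continuous : continuous (fun p : 'rV[R]_n * U => clamped p.1 p.2).
Proof.
move=> [p v]; apply/cvgrPdist_lt => e e0.
have [[A B] /= [/nbhs_ballP[d /= d0 dA] Bv] AB] := near_rhs openX f_continuous v (clampX p) e0.
exists (ball p d, B); first by split=> //; apply/nbhs_ballP; exists d.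
move=> [q w] /= [pq Bw]; rewrite distrC; apply: (AB (_, _)); split=> //=.
apply: dA; move: pq; rewrite -!ball_normE /ball_/=.
exact: le_lt_trans (clamp_lipschitz _ _ _ _).
Qed.

Lemma clamped_locally_Lipschitz : locally_Lipschitz [set: 'rV[R]_n] clamped.
Proof.
move=> p U0 _ cU0; have [V [L [Vp VX VL]]] := f_lipschitz (clampX p) cU0.
have [d /= d0 dV] := (nbhs_ballP _ _).1 Vp.
have cV q : ball p d q -> V (clamp xbar s q).
  move=> pq; apply: dV; move: pq; rewrite -!ball_normE /ball_/=.
  exact: le_lt_trans (clamp_lipschitz _ _ _ _).
exists (ball p d), `|L|; split=> //; first by apply/nbhs_ballP; exists d.
move=> x z v px pz Uv; apply: (le_trans (VL _ _ _ (cV _ px) (cV _ pz) Uv)).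
apply: (@le_trans _ _ (`|L| * enorm (clamp xbar s x - clamp xbar s z))).
  by rewrite ler_wpM2r ?sqrtr_ge0// ler_norm.
by rewrite ler_wpM2l// enorm_clamp_lipschitz.
Qed.

(** f(., ubar) is bounded on the compact box, and f(., v) differs from it by at
most 1 for v near ubar. *)
Lemma clamped_bounded : exists d M, [/\ 0 < d, 0 <= M &
  forall p v, mdist v ubar < d -> `|clamped p v| <= M].
Proof.
have cB := @compact_closed_ball R n xbar s.
have /near_covering_withinP cov := (compact_near_coveringP _).1 cB.
have [M [Mreal HM]] : \forall i \near pinfty_nbhs R,
    [set q | `|q - xbar| <= s] `<=` (fun i q => `|f q ubar| <= i) i.
  apply: cov => p /box_sub Xp.
  have := near_rhs openX f_continuous ubar Xp ltr01 => -[[A B] /= [Ap Bv] AB].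
  exists (A, [set i | `|f p ubar| + 1 < i]).
    by split=> //=; apply: nbhs_pinfty_gt; exact: num_real.
  move=> [q i] /= [Aq pi] _; apply: le_trans (ltW pi).
  rewrite -(subrK (f p ubar) (f q ubar)) (le_trans (ler_normD _ _))// addrC lerD2l ltW//.
  by apply: (AB (q, ubar)); split=> //=; exact: nbhs_singleton.
have [d d0 fd] := rhs_uniform_in_input openX f_continuous ubar cB box_sub ltr01.
exists d, (`|M| + 2); split=> // p v vd.
have pB := clamp_in xbar s0 p.
rewrite /clamped -(subrK (f (clamp xbar s p) ubar) (f _ v)) (le_trans (ler_normD _ _))//.
have h1 := fd _ _ pB vd.
have h2 : `|f (clamp xbar s p) ubar| <= `|M| + 1.
  by apply: HM => //; rewrite ltr_pwDr// ler_norm.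
by rewrite addrC (le_trans (lerD h2 h1))// -addrA.
Qed.

(** For clamped states closer than the radius r of a Lipschitz tube around the box,
the tube gives the constant L; for the others the bound M on the right-hand side
gives (M + M) / r. *)
Lemma clamped_lipschitz (U0 : set U) d M : compact U0 -> 0 <= M ->
  (forall p v, mdist v ubar < d -> `|clamped p v| <= M) ->
  exists2 L, 0 <= L & forall p q v, U0 v -> mdist v ubar < d ->
    `|clamped p v - clamped q v| <= L * `|p - q|.
Proof.
move=> cU0 M0 FM.
have [r [L [r0 L0 rL]]] :=
  lipschitz_tube f_lipschitz (@compact_closed_ball R n xbar s) box_sub cU0.
exists (L + (M + M) / r); first by rewrite addr_ge0// divr_ge0 ?addr_ge0// ltW.
move=> p q v Uv vd.
have pq := clamp_lipschitz xbar s p q.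
apply: (@le_trans _ _ ((L + (M + M) / r) * `|clamp xbar s p - clamp xbar s q|)); last first.
  by rewrite ler_wpM2l// addr_ge0// divr_ge0 ?addr_ge0// ltW.
rewrite mulrDl; have [pqr|rpq] := ltP `|clamp xbar s p - clamp xbar s q| r.
  have [_ /(_ _ Uv)] := rL _ _ (clamp_in xbar s0 q) pqr.
  by move=> /le_trans; apply; rewrite lerDl mulr_ge0// divr_ge0 ?addr_ge0// ltW.
apply: (@le_trans _ _ (M + M)).
  by rewrite (le_trans (ler_normB _ _))// lerD// FM.
apply: (@le_trans _ _ ((M + M) / r * `|clamp xbar s p - clamp xbar s q|)).
  rewrite mulrAC -mulrA ler_peMr ?addr_ge0//.
  by rewrite ler_pdivlMr// mul1r.
by rewrite lerDr mulr_ge0.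
Qed.

Lemma solves_clamped u a b x : (forall t, a <= t <= b -> `|x t - xbar| <= s) ->
  solves X f u a b x <-> solves [set: 'rV[R]_n] clamped u a b x.
Proof.
move=> xs; split=> -[xX acx dx]; split=> //.
- by apply: ae_imply dx => t dx tab; rewrite /clamped clamp_id ?xs//; exact: dx.
- by move=> t /xs/box_sub.
- by apply: ae_imply dx => t dx tab; have := dx tab; rewrite /clamped clamp_id ?xs.
Qed.

End ClampedSystem.

(** * The perturbed system *)

Section PerturbedSystem.
Variables (R : realType) (n : nat) (U : metricType R).
Variables (X : set 'rV[R]_n) (f : 'rV[R]_n -> U -> 'rV[R]_n).
Variables (xbar : 'rV[R]_n) (ubar : U).
Notation mu := (@lebesgue_measure R).
Notation half_line := (half_line (R:=R)).
Hypothesis openX : open X.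
Hypothesis f_continuous :
  {within X `*` [set: U], continuous (fun p : 'rV[R]_n * U => f p.1 p.2)}.
Hypothesis f_lipschitz : locally_Lipschitz X f.
Hypothesis Xxbar : X xbar.

Lemma half_line_solves u x a b : 0 <= a -> a <= b ->
  is_solution X f u half_line x -> solves X f u a b x.
Proof.
move=> a0 ab; apply: is_solution_solves => // t; rewrite /= in_itv/= => /andP[at_ _].
exact: le_trans at_.
Qed.

Lemma attraction_domain_attracted p : attraction_domain X f xbar ubar p ->
  exists2 y, attracted X f xbar ubar y & y 0 = p.
Proof.
move=> [_ [y [[[_ _ _ y0 sy] _] cy]]]; exists y => //; split=> // b b0.
exact: half_line_solves sy.
Qed.

(** Lyapunov stability provides a trajectory that stays close to xbar and local
attractivity one that converges to it; both are maximal, hence equal. *)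
Lemma stable_attracted : asymptotically_stable X f xbar ubar ->
  forall e : R, 0 < e -> exists2 d, 0 < d & forall p, `|p - xbar| < d ->
  exists y, [/\ attracted X f xbar ubar y, y 0 = p & forall t, 0 <= t -> `|y t - xbar| < e].
Proof.
move=> [stab [d1 d10 attr]] e e0; have [d2 d20 lyap] := stab e e0.
have [r /= r0 rX] := (nbhs_ballP _ _).1 (open_nbhs_nbhs (conj openX Xxbar)).
have n1 : 0 < Num.sqrt n%:R + 1 :> R by rewrite ltr_wpDl// sqrtr_ge0.
exists (Num.min r (Num.min d1 d2 / (Num.sqrt n%:R + 1))).
  by rewrite lt_min r0 divr_gt0// lt_min d10.
move=> p; rewrite lt_min => /andP[pr /enorm_small]; rewrite lt_min => /andP[pd1 pd2].
have Xp : X p by apply: rX; rewrite -ball_normE /ball_/= distrC.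
have [y [yphi ye]] := lyap _ Xp pd2.
have [_ [y' [[y'f _] cy']]] := attr _ Xp pd1.
have [yf ymax] := yphi; have [_ y'y] := ymax _ _ y'f.
have [_ _ _ y0 sy] := yf.
exists y; split=> // [|t t0]; last exact: le_lt_trans (norm_le_enorm _) (ye t t0).
split=> [b b0|]; first exact: half_line_solves sy.
apply: cvg_trans cy'; apply: near_eq_cvg; exists 0; split=> // t t0.
by apply: y'y; exact: ltW.
Qed.

Lemma input_norm_lt (u : R -> U) d : (input_norm ubar half_line u < d%:E)%E ->
  {ae mu, forall t : R, 0 <= t -> mdist (u t) ubar < d}.
Proof.
move=> ud; have := ess_sup_ge mu ((fun t => (mdist (u t) ubar)%:E) \_ half_line).
apply: ae_imply => t; rewrite patchE => ut t0; rewrite mem_set// in ut.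
by rewrite -lte_fin; exact: le_lt_trans ut ud.
Qed.

(** On [0, t] the input takes almost all its values in a compact set, for which f
has Lipschitz tubes. *)
Lemma forward_solution_unique u xi J x y : is_input half_line u ->
  is_forward_solution X f xi u half_line x -> is_forward_solution X f xi u J y ->
  forall t, J t -> y t = x t.
Proof.
move=> [_ uK] [_ _ _ x0 sx] [itvJ Jh J0 y0 sy] t Jt.
have t0 : 0 <= t := Jh _ Jt.
have tJ : `[0, t] `<=` J.
  by move=> s; rewrite /= in_itv/= => st; exact: (itvJ _ _ J0 Jt).
have [U0 cU0 uU0] := uK `[0, t]%classic (subset_trans tJ Jh) (@segment_compact _ 0 t).
apply: (solves_unique f_lipschitz t0 cU0 _ _ _ (etrans y0 (esym x0))).
- by apply: ae_imply uU0 => s H st; apply: H; rewrite /= in_itv.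
- exact: is_solution_solves sy.
- exact: half_line_solves sx.
Qed.

Lemma convergence_of_recurrent (K : set 'rV[R]_n) (u : R -> U) (x : R -> 'rV[R]_n) :
  asymptotically_stable X f xbar ubar ->
  compact K -> K `<=` attraction_domain X f xbar ubar ->
  u t @[t --> +oo] --> ubar -> is_solution X f u half_line x -> recurrent K x ->
  x t @[t --> +oo] --> xbar.
Proof.
move=> stab cK KO cu sx recx.
apply: (recurrent_cvg openX f_continuous f_lipschitz (stable_attracted stab) cK _ cu _ recx).
- by move=> p /KO/attraction_domain_attracted.
- by move=> a b a0 ab; exact: half_line_solves sx.
Qed.

(** The box radius s is small enough for the box to lie in X and for points closer
than s to xbar in the maximum norm to be closer than e in the Euclidean norm. *)
Lemma stability_under_small_inputs e : asymptotically_stable X f xbar ubar -> 0 < e ->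
  exists2 d : R, 0 < d & forall (xi : 'rV[R]_n) (u : R -> U),
    enorm (xi - xbar) < d -> is_input half_line u ->
    (input_norm ubar half_line u < d%:E)%E ->
    exists x : R -> 'rV[R]_n, is_phi X f xi u half_line x /\
      forall t : R, 0 <= t -> enorm (x t - xbar) < e.
Proof.
move=> stab e0.
have n1 : 0 < Num.sqrt n%:R + 1 :> R by rewrite ltr_wpDl// sqrtr_ge0.
have [r /= r0 rX] := (nbhs_ballP _ _).1 (open_nbhs_nbhs (conj openX Xxbar)).
pose s := Num.min (r / 2) (e / (Num.sqrt n%:R + 1)).
have s0 : 0 < s by rewrite lt_min !divr_gt0.
have boxX : [set q | `|q - xbar| <= s] `<=` X.
  move=> q /= qs; apply: rX; rewrite -ball_normE /ball_/= distrC.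
  apply: (le_lt_trans qs); rewrite gt_min ltr_pdivrMr// ltr_pMr//.
  by rewrite ltrDl ltr01.
pose F := clamped f xbar s.
have Fcont : continuous (fun p : 'rV[R]_n * U => F p.1 p.2).
  exact: clamped_continuous (ltW s0) boxX.
have Flip : locally_Lipschitz [set: 'rV[R]_n] F.
  exact: clamped_locally_Lipschitz (ltW s0) boxX.
have stabF : forall e : R, 0 < e -> exists2 d, 0 < d & forall p, `|p - xbar| < d ->
    exists y, [/\ attracted [set: 'rV[R]_n] F xbar ubar y, y 0 = p &
      forall t, 0 <= t -> `|y t - xbar| < e].
  move=> e' e'0; have es0 : 0 < Num.min e' s by rewrite lt_min e'0.
  have [d d0 ref] := stable_attracted stab es0; exists d => // p /ref[y [[sy cy] y0 ye]].
  have ys t : 0 <= t -> `|y t - xbar| < e' /\ `|y t - xbar| <= s.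
    by move=> /ye; rewrite lt_min => /andP[? /ltW].
  exists y; split=> // [|t /ys[]//]; split=> // b b0.
  have yb t : 0 <= t <= b -> `|y t - xbar| <= s by move=> /andP[/ys[]].
  by apply/(solves_clamped f boxX _ yb); exact: sy.
have [d [eta [d0 eta0 close]]] := total_stability openT
  (continuous_subspaceT Fcont) Flip stabF s0.
have [dM [M [dM0 M0 FM]]] := clamped_bounded ubar openX f_continuous (ltW s0) boxX.
exists (Num.min d (Num.min eta dM)); first by rewrite !lt_min d0 eta0.
move=> xi u; rewrite lt_min => /andP[xid _] inu /input_norm_lt ud.
have [mu_ uK] := inu.
have uM : {ae mu, forall t : R, 0 <= t -> mdist (u t) ubar < dM}.
  by apply: ae_imply ud => t ud /ud; rewrite !lt_min => /and3P[].
have [||x [x0 xM dx]] := caratheodory_existence xi Fcont mu_ M0.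
- by apply: ae_imply uM => t uM t0 p; apply: FM; exact: uM.
- move=> T T0; have TI : `[0, T] `<=` half_line.
    by move=> t; rewrite /= in_itv/= => /andP[].
  have [U0 cU0 uU0] := uK _ TI (@segment_compact _ 0 T).
  have [L L0 FL] := clamped_lipschitz f_lipschitz (ltW s0) boxX cU0 M0 FM.
  exists L => //; apply: ae_imply (ae_and uM uU0) => t [{}uM {}uU0] tT p q.
  apply: FL; first by apply: uU0; rewrite /= in_itv.
  by apply: uM; case/andP: tT.
have lipx a b : abs_continuous a b x.
  apply: (@lipschitz_abs_continuous _ _ _ _ M) => p q _ pq _.
  by rewrite (le_trans (xM _ _))// ger0_norm// subr_ge0.
have sx b : 0 <= b -> solves [set: 'rV[R]_n] F u 0 b x.
  move=> b0; split=> //; first exact: abs_continuous_ac.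
  by apply: ae_imply dx => t dx /andP[t0 _]; exact: dx.
have xs t : 0 <= t -> `|x t - xbar| < s.
  apply: (close u 0 x sx).
    by rewrite x0 (le_trans (norm_le_enorm _))// ltW.
  by apply: ae_imply ud => r' ud /ud; rewrite !lt_min => /and3P[].
have fx : is_forward_solution X f xi u half_line x.
  split=> //.
  - by move=> a b a0 _ c /andP[ac _]; exact: le_trans ac.
  - exact: lexx.
  split.
  - by move=> t t0; apply: boxX; exact/ltW/xs.
  - by move=> a b _ _; exact: lipx.
  - apply: ae_imply dx => t dx t0; have := dx t0.
    by rewrite /F /clamped clamp_id// ltW// xs.
exists x; split.
  split=> // J y yf; split; first by case: yf.
  exact: forward_solution_unique inu fx yf.
move=> t t0; apply: enorm_small; apply: lt_le_trans (xs t t0) _.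
by rewrite ge_min lexx orbT.
Qed.

End PerturbedSystem.

Theorem theorem1 (R : realType) (n : nat) (U : metricType R)
    (X : set 'rV[R]_n) (f : 'rV[R]_n -> U -> 'rV[R]_n)
    (xbar : 'rV[R]_n) (ubar : U) :
  open X ->
  {within X `*` [set: U], continuous (fun p : 'rV[R]_n * U => f p.1 p.2)} ->
  locally_Lipschitz X f ->
  X xbar ->
  f xbar ubar = 0 ->
  asymptotically_stable X f xbar ubar ->
  (forall (K : set 'rV[R]_n) (u : R -> U) (x : R -> 'rV[R]_n),
     compact K -> K `<=` attraction_domain X f xbar ubar ->
     is_input (half_line (R:=R)) u ->
     u t @[t --> +oo] --> ubar ->
     is_solution X f u (half_line (R:=R)) x ->
     recurrent K x ->
     x t @[t --> +oo] --> xbar)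
  /\
  (forall e : R, 0 < e -> exists2 d : R, 0 < d &
     forall (xi : 'rV[R]_n) (u : R -> U),
       X xi -> enorm (xi - xbar) < d ->
       is_input (half_line (R:=R)) u ->
       (input_norm ubar (half_line (R:=R)) u < d%:E)%E ->
       exists x : R -> 'rV[R]_n,
         is_phi X f xi u (half_line (R:=R)) x /\
         forall t : R, 0 <= t -> enorm (x t - xbar) < e).
Proof.
move=> openX f_cont f_lip Xxbar _ stab; split.
- move=> K u x cK KO _; exact: convergence_of_recurrent.
- move=> e e0; have [d d0 small] :=
    stability_under_small_inputs openX f_cont f_lip Xxbar stab e0.
  by exists d => // xi u _; exact: small.
Qed.
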